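(* For each weakly topological structure $\mathcal M$, the category $\mathbf{LDS}(\mathcal M)$ of locally definable spaces over $\mathcal M$ is finitely complete (it has all finite limits).
   Context: For a family of sets $\mathcal U$ and a set $V$, $V\underline{\cap}\,\mathcal U=\{V\cap U: U\in\mathcal U\}$. For a set $\Phi$ of families of sets, $\underline{\bigcup}\Phi=\{\bigcup\mathcal U:\mathcal U\in\Phi\}$. $\mathcal U\preceq\mathcal V$ means that $\bigcup\mathcal U=\bigcup\mathcal V$ and every member of $\mathcal U$ is contained in some member of $\mathcal V$. A generalized topological space (gts) is a triple $(X,Op_X,Cov_X)$, where $X$ is a set, $Op_X\subseteq\mathcal P(X)$ (the open sets) and $Cov_X\subseteq\mathcal P(Op_X)$ (the admissible families), such that: (finiteness) if $\mathcal U$ is a finite subfamily of $Op_X$, then $\bigcup\mathcal U,\bigcap\mathcal U\in Op_X$ (with $\bigcup\emptyset=\emptyset$, $\bigcap\emptyset=X$) and $\mathcal U\in Cov_X$; (stability) if $V\in Op_X$ and $\mathcal U\in Cov_X$, then $V\underline{\cap}\,\mathcal U\in Cov_X$; (transitivity) if $\Phi\subseteq Cov_X$ and $\underline{\bigcup}\Phi\in Cov_X$, then $\bigcup\Phi\in Cov_X$; (saturation) if $\mathcal U\in Cov_X$, $\mathcal V\subseteq Op_X$ and $\mathcal U\preceq\mathcal V$, then $\mathcal V\in Cov_X$; (regularity) if $W\subseteq X$, $\mathcal U\in Cov_X$ and $W\underline{\cap}\,\mathcal U\subseteq Op_X$, then $W\cap\bigcup\mathcal U\in Op_X$. A mapping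 between gtses is strictly continuous if the preimage $\{f^{-1}(U):U\in\mathcal U\}$ of every admissible family $\mathcal U$ is an admissible family. A family is essentially finite if some finite subfamily has the same union. A weakly topological structure is a (one-sorted, first order) structure $\mathcal M$ together with a topology on its underlying set $M$; each cartesian power $M^n$ carries the product topology. ''Definable'' means definable in $\mathcal M$ with parameters. A function sheaf over $\mathcal M$ on a gts $X$ is a sheaf $F$ of sets on $X$ (the sheaf property being required only for admissible coverings) such that $F(U)\subseteq M^U$ (functions $U\to M$) for each open $U$, with restriction of functions as restriction maps. A space over $\mathcal M$ is a pair $(X,O_X)$ with $X$ a gts and $O_X$ a function sheaf over $\mathcal M$ on $X$. A morphism $(X,O_X)\to(Y,O_Y)$ is a strictly continuous $f:X\to Y$ such that $h\circ f\in O_X(f^{-1}(V))$ for every open $V\subseteq Y$ and $h\in O_Y(V)$. These form the category $\mathbf{Space}(\mathcal M)$. An open subspace of $(X,O_X)$ is an open subset $U$ with the open sets and admissible families of $X$ contained in $U$ and with $O_X$ restricted to $U$. Each definable set $D\subseteq M^n$ is regarded as a space over $\mathcal M$: open sets are the relatively open definable subsets of $D$, admissible families are the essentially finite families of open sets, and $O_D(U)$ is the set of all definable continuous functions $U\to M$. An affine definable space over $\mathcal M$ is a space over $\mathcal M$ isomorphic to some such $D$. A locally definable space over $\mathcal M$ is a space over $\mathcal M$ that has an admissible covering by affine definable open subspaces. $\mathbf{LDS}(\mathcal M)$ is the full subcategory of $\mathbf{Space}(\mathcal M)$ whose objects are the locally definable spaces. *)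

(* Defs.v *)
From mathcomp Require Import all_boot.
From mathcomp Require Import boolp classical_sets functions.
From mathcomp Require Import cardinality topology.

Set Implicit Arguments.
Unset Strict Implicit.
Unset Printing Implicit Defensive.

Local Open Scope classical_set_scope.

(** * Categories and finite limits *)

Record category := Category {
  ob :> Type;
  hom : ob -> ob -> Type;
  idc : forall x, hom x x;
  comp : forall x y z, hom y z -> hom x y -> hom x z;
  comp_idl : forall x y (f : hom x y), comp (idc y) f = f;
  comp_idr : forall x y (f : hom x y), comp f (idc x) = f;
  compA : forall w x y z (h : hom y z) (g : hom x y) (f : hom w x),
    comp h (comp g f) = comp (comp h g) f }.

Arguments hom {c} _ _.
Arguments idc {c} _.
Arguments comp {c x y z} _ _.

Definition isomorphic (C : category) (x y : C) : Prop :=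
  exists (f : hom x y) (g : hom y x), comp g f = idc x /\ comp f g = idc y.

Definition full_subcategory (C : category) (P : C -> Prop) : category :=
  @Category {x : C | P x} (fun x y => hom (sval x) (sval y))
    (fun x => idc (sval x)) (fun _ _ _ g f => comp g f)
    (fun _ _ f => comp_idl f) (fun _ _ f => comp_idr f)
    (fun _ _ _ _ h g f => compA h g f).

Record functor (J C : category) := Functor {
  fob :> J -> C;
  fmap : forall i j, hom i j -> hom (fob i) (fob j);
  fmap_id : forall i, fmap (idc i) = idc (fob i);
  fmap_comp : forall i j k (b : hom j k) (a : hom i j),
    fmap (comp b a) = comp (fmap b) (fmap a) }.

Arguments fmap {J C} _ {i j} _.

Record cone (J C : category) (F : functor J C) := Cone {
  apex : C;
  leg : forall j, hom apex (F j);
  leg_natural : forall i j (a : hom i j), comp (fmap F a) (leg i) = leg j }.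

Definition is_limit (J C : category) (F : functor J C) (L : cone F) : Prop :=
  forall K : cone F,
    exists! u : hom (apex K) (apex L), forall j, comp (leg L j) u = leg K j.

(* Not finite_set [set: T]: set is not universe polymorphic, and the universe of
   the types it applies to contains the carriers of the spaces below, hence must
   be smaller than the universe of the objects of a category. *)
Definition finite_type (T : Type) : Prop :=
  exists n (e : 'I_n -> T), forall x, exists i, e i = x.

Definition finite_category (J : category) : Prop :=
  finite_type J /\ forall i j : J, finite_type (hom i j).

Definition finitely_complete (C : category) : Prop :=
  forall J : category, finite_category J ->
  forall F : functor J C, exists L : cone F, is_limit L.

(** * Weakly topological structures and definable sets *)

Record signature := Signature {
  fsym : Type;
  farity : fsym -> nat;
  rsym : Type;
  rarity : rsym -> nat }.

(* The underlying set is allowed to be empty. *)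
Record wt_structure (L : signature) := WTStructure {
  wt_carrier :> topologicalType;
  finterp : forall s : fsym L, ('I_(farity s) -> wt_carrier) -> wt_carrier;
  rinterp : forall s : rsym L, ('I_(rarity s) -> wt_carrier) -> Prop }.

Section Definability.
Context {L : signature} (M : wt_structure L).

(* Terms and formulas with parameters from M and free variables in 'I_n. *)
Inductive term (n : nat) : Type :=
| Var of 'I_n
| Par of M
| App (s : fsym L) of ('I_(farity s) -> term n).

Inductive formula : nat -> Type :=
| Eq n : term n -> term n -> formula n
| Rel n (s : rsym L) : ('I_(rarity s) -> term n) -> formula n
| Not n : formula n -> formula n
| And n : formula n -> formula n -> formula n
| Ex n : formula n.+1 -> formula n.

(* (x_0, ..., x_(n-1)), y |-> (x_0, ..., x_(n-1), y) *)
Definition snoc {T : Type} n (x : 'I_n -> T) (y : T) : 'I_n.+1 -> T :=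
  fun i => oapp x y (unlift ord_max i).

Fixpoint eval n (x : 'I_n -> M) (t : term n) : M :=
  match t with
  | Var i => x i
  | Par a => a
  | App s ts => finterp (fun i => eval x (ts i))
  end.

Fixpoint holds n (p : formula n) : ('I_n -> M) -> Prop :=
  match p with
  | Eq _ t u => fun x => eval x t = eval x u
  | Rel _ s ts => fun x => rinterp (fun i => eval x (ts i))
  | Not _ p => fun x => ~ holds p x
  | And _ p q => fun x => holds p x /\ holds q x
  | Ex _ p => fun x => exists y, holds p (snoc x y)
  end.

Definition definable n (A : set {ptws 'I_n -> M}) : Prop :=
  exists p : formula n, A = [set x | holds p x].

Lemma snoc_lift (T : Type) n (x : 'I_n -> T) y : snoc x y \o lift ord_max = x.
Proof. by apply/funext => i; rewrite /snoc /= liftK. Qed.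

Lemma snoc_max (T : Type) n (x : 'I_n -> T) y : snoc x y ord_max = y.
Proof. by rewrite /snoc unlift_none. Qed.

Fixpoint tren m n (r : 'I_m -> 'I_n) (t : term m) : term n :=
  match t with
  | Var i => Var (r i)
  | Par a => Par n a
  | App s ts => App (fun i => tren r (ts i))
  end.

Definition rup m n (r : 'I_m -> 'I_n) : 'I_m.+1 -> 'I_n.+1 :=
  snoc (lift ord_max \o r) ord_max.

Fixpoint fren m (p : formula m) : forall n, ('I_m -> 'I_n) -> formula n :=
  match p with
  | Eq _ t u => fun _ r => Eq (tren r t) (tren r u)
  | Rel _ s ts => fun _ r => Rel (fun i => tren r (ts i))
  | Not _ p => fun _ r => Not (fren p r)
  | And _ p q => fun _ r => And (fren p r) (fren q r)
  | Ex _ p => fun _ r => Ex (fren p (rup r))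
  end.

Lemma eval_tren m n (r : 'I_m -> 'I_n) (x : 'I_n -> M) t :
  eval x (tren r t) = eval (x \o r) t.
Proof.
elim: t => //= s ts IH; congr finterp.
by apply/funext => i; exact: IH.
Qed.

Lemma snoc_rup m n (r : 'I_m -> 'I_n) (x : 'I_n -> M) y :
  snoc x y \o rup r = snoc (x \o r) y.
Proof.
apply/funext => i; rewrite /rup /= {2 3}/snoc.
by case: unliftP => [j|] _ /=; rewrite /snoc ?liftK ?unlift_none.
Qed.

Lemma holds_fren m (p : formula m) n (r : 'I_m -> 'I_n) (x : 'I_n -> M) :
  holds (fren p r) x <-> holds p (x \o r).
Proof.
elim: p n r x => {m} [m t u|m s ts|m p IH|m p IHp q IHq|m p IH] n r x /=.
- by rewrite !eval_tren.
- suff -> : (fun i => eval x (tren r (ts i))) = (fun i => eval (x \o r) (ts i)).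
    by [].
  by apply/funext => i; rewrite eval_tren.
- by split=> h /IH.
- by split=> -[/IHp ? /IHq ?].
- by split=> -[y] hy; exists y; move: hy; rewrite IH snoc_rup.
Qed.

Lemma definableT n : definable [set: {ptws 'I_n -> M}].
Proof.
pose p : formula n := Ex (Eq (Var ord_max) (Var ord_max)).
exists (Not (And p (Not p))).
by apply/seteqP; split=> // x _ [] ? /(_ _).
Qed.

Lemma definableC n (A : set {ptws 'I_n -> M}) : definable A -> definable (~` A).
Proof. by move=> [p ->]; exists (Not p). Qed.

Lemma definableI n (A B : set {ptws 'I_n -> M}) :
  definable A -> definable B -> definable (A `&` B).
Proof. by move=> [p ->] [q ->]; exists (And p q). Qed.

Lemma definableU n (A B : set {ptws 'I_n -> M}) :
  definable A -> definable B -> definable (A `|` B).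
Proof.
move=> dA dB; rewrite -[_ `|` _]setCK setCU.
by apply: definableC; apply: definableI; apply: definableC.
Qed.

Lemma definable0 n : definable (set0 : set {ptws 'I_n -> M}).
Proof. by rewrite -setCT; apply/definableC/definableT. Qed.

Lemma definable_bigcup n (I : choiceType) (P : set I)
    (F : I -> set {ptws 'I_n -> M}) :
  finite_set P -> (forall i, P i -> definable (F i)) ->
  definable (\bigcup_(i in P) F i).
Proof.
move=> finP dF; rewrite -bigsetU_fset_set // big_seq.
elim/big_ind: _ => [|A B|i]; [exact: definable0|exact: definableU|].
by rewrite in_fset_set // inE => /dF.
Qed.

Lemma definable_preim m n (r : 'I_m -> 'I_n) (A : set {ptws 'I_m -> M}) :
  definable A -> definable [set x : {ptws 'I_n -> M} | A (x \o r)].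
Proof.
move=> [p ->]; exists (fren p r).
by apply/seteqP; split=> x /=; rewrite holds_fren.
Qed.

End Definability.

(** * Generalized topological spaces *)

Section Families.
Context {T : Type}.
Implicit Types U V : set (set T).

Definition famI (V : set T) (U : set (set T)) : set (set T) :=
  [set V `&` W | W in U].

Definition finer U V : Prop :=
  \bigcup_(A in U) A = \bigcup_(B in V) B /\
  forall A, U A -> exists2 B, V B & A `<=` B.

Definition essentially_finite U : Prop :=
  exists V, [/\ finite_set V, V `<=` U & \bigcup_(B in V) B = \bigcup_(A in U) A].

End Families.

(* \bigcap_(A in set0) A is setT, as required by the convention on empty
   intersections. *)
Record gts := Gts {
  gts_carrier :> Type;
  gop : set (set gts_carrier);
  gcov : set (set (set gts_carrier));
  gcov_gop : forall U, gcov U -> U `<=` gop;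
  gts_finite : forall U, finite_set U -> U `<=` gop ->
    [/\ gop (\bigcup_(A in U) A), gop (\bigcap_(A in U) A) & gcov U];
  gts_stable : forall V U, gop V -> gcov U -> gcov (famI V U);
  gts_trans : forall Phi : set (set (set gts_carrier)), Phi `<=` gcov ->
    gcov [set \bigcup_(A in U) A | U in Phi] -> gcov (\bigcup_(U in Phi) U);
  gts_saturated : forall U V, gcov U -> V `<=` gop -> finer U V -> gcov V;
  gts_regular : forall W U, gcov U -> famI W U `<=` gop ->
    gop (W `&` \bigcup_(A in U) A) }.

Arguments gop {g}.
Arguments gcov {g}.

Definition strictly_continuous (X Y : gts) (f : X -> Y) : Prop :=
  forall U : set (set Y), gcov U -> gcov [set f @^-1` A | A in U].

Section GtsTheory.
Context (X : gts).

Lemma gop_bigcup (U : set (set X)) : gcov U -> gop (\bigcup_(A in U) A).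
Proof.
move=> cU; rewrite -[X in gop X]setTI; apply: gts_regular => // _ [A UA <-].
by rewrite setTI; exact: gcov_gop UA.
Qed.

Lemma gopI (A B : set X) : gop A -> gop B -> gop (A `&` B).
Proof.
move=> oA oB; have [|_ + _] := @gts_finite X [set A; B] (finite_set2 A B).
  by move=> _ [->|->].
by rewrite bigcap_setU !bigcap_set1.
Qed.

Lemma gopT : gop [set: X].
Proof.
have [|_ + _] := @gts_finite X set0 (finite_set0 _); first by move=> ?.
by rewrite bigcap_set0.
Qed.

End GtsTheory.

Lemma preimage_gop (X Y : gts) (f : X -> Y) (V : set Y) :
  strictly_continuous f -> gop V -> gop (f @^-1` V).
Proof.
move=> fc oV; have [|_ _ /fc] := @gts_finite Y [set V] (finite_set1 V).
  by move=> _ ->.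
by rewrite image_set1 => /gcov_gop; exact.
Qed.

(** * Function sheaves *)

Definition smap (X Y : Type) (f : X -> Y) (U : set X) (V : set Y)
    (h : U `<=` f @^-1` V) : U -> V :=
  fun x => exist _ (f (val x)) (mem_set (h (val x) (set_valP x))).

Definition restr (X T : Type) (U V : set X) (VU : V `<=` U) (f : U -> T) :
  V -> T := f \o @smap X X id V U VU.

(* The values of a sheaf at non-open sets are junk: every condition, here and
   below, only concerns its values at open sets. *)
Record function_sheaf (M : Type) (X : gts) := FunctionSheaf {
  sec :> forall U : set X, set (U -> M);
  sec_restr : forall (U V : set X) (VU : V `<=` U), gop U -> gop V ->
    forall f, sec f -> sec (restr VU f);
  sec_sheaf : forall U : set (set X), gcov U ->
    forall s : (forall V : U, set_type (val V) -> M),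
    (forall V, sec (s V)) ->
    (forall V W, restr (@subIsetl _ (val V) (val W)) (s V) =
                 restr (@subIsetr _ (val V) (val W)) (s W)) ->
    exists! f : \bigcup_(A in U) A -> M, sec f /\
      forall V : U, restr (bigcup_sup (F := id) (set_valP V)) f = s V }.

Record space (M : Type) := Space {
  space_gts :> gts;
  space_sheaf : function_sheaf M space_gts }.

Section GlueFunctions.
Context (M : Type) (X : gts) (F : forall U : set X, set (U -> M)).

Lemma glue_functions :
  (forall (U : set (set X)) (f : \bigcup_(A in U) A -> M), gcov U ->
    (forall (A : set X) (AU : A `<=` \bigcup_(A in U) A),
      U A -> F (restr AU f)) -> F f) ->
  forall U : set (set X), gcov U ->
    forall s : (forall V : U, set_type (val V) -> M),
    (forall V, F (s V)) ->
    (forall V W, restr (@subIsetl _ (val V) (val W)) (s V) =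
                 restr (@subIsetr _ (val V) (val W)) (s W)) ->
    exists! f : \bigcup_(A in U) A -> M, F f /\
      forall V : U, restr (bigcup_sup (F := id) (set_valP V)) f = s V.
Proof.
move=> Fglue U cU s Fs sE.
have sval_eq (A : set X) (x y : A) : val x = val y -> x = y by exact: val_inj.
have ex (x : \bigcup_(A in U) A) :
    exists y, forall (V : U) (z : set_type (val V)), val z = val x -> s V z = y.
  have [A UA Ax] := set_valP x.
  pose W : U := exist _ A (mem_set UA).
  exists (s W (exist _ (val x) (mem_set Ax))) => V z zx.
  have Vx : val V (val x) by rewrite -zx; exact: set_valP.
  have := congr1 (@^~ (exist _ (val x) (mem_set (conj Vx Ax)))) (sE V W).
  rewrite /restr /= => h.
  transitivity (s V (smap (@subIsetl _ (val V) (val W))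
      (exist _ (val x) (mem_set (conj Vx Ax))))).
    by congr (s V _); apply: sval_eq.
  by rewrite h; congr (s W _); apply: sval_eq.
pose f x := sval (cid (ex x)).
have fE (V : U) (h : val V `<=` \bigcup_(A in U) A) : restr h f = s V.
  apply/funext => x; rewrite /restr /= /f; case: cid => y /= /(_ V x) -> //.
exists f; split=> [|g [_ gE]].
  split=> [|V]; last exact: fE.
  apply: Fglue => // A AU UA; pose V : U := exist _ A (mem_set UA).
  by have := Fs V; rewrite -(fE V AU).
apply/funext => x; have [A UA Ax] := set_valP x.
pose V : U := exist _ A (mem_set UA).
pose z : set_type (val V) := exist _ (val x) (mem_set Ax).
have := congr1 (@^~ z) (gE V); rewrite -(fE V (bigcup_sup (F := id) (set_valP V))).
rewrite /restr /=; set a := smap _ _.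
by have -> : a = x by exact: val_inj.
Qed.

(* Conversely, a function that is locally a section is a section. *)
Lemma sec_local (G : function_sheaf M X) (U : set (set X))
    (f : \bigcup_(A in U) A -> M) : gcov U ->
  (forall (A : set X) (AU : A `<=` \bigcup_(A in U) A),
    U A -> G A (restr AU f)) -> G _ f.
Proof.
move=> cU Gf.
have [|V W|g [[Gg gE] _]] := @sec_sheaf M X G U cU
    (fun V => restr (bigcup_sup (F := id) (set_valP V)) f).
- by move=> V; apply: Gf; exact: set_valP.
- by apply/funext => x; congr f; apply: val_inj.
suff <- : g = f by [].
apply/funext => x; have [A UA Ax] := set_valP x.
pose V : U := exist _ A (mem_set UA).
pose z : set_type (val V) := exist _ (val x) (mem_set Ax).
have := congr1 (@^~ z) (gE V); rewrite /restr /=; set a := smap _ _.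
by have -> : a = x by exact: val_inj.
Qed.

End GlueFunctions.

(** * The category of spaces over M *)

Section SpaceCategory.
Context (M : Type).
Implicit Types X Y Z : space M.

Definition pullback (X Y : Type) (f : X -> Y) (V : set Y) (h : V -> M) :
  f @^-1` V -> M := h \o @smap X Y f (f @^-1` V) V (fun _ => id).
Arguments pullback {X Y} f {V} h _.

Record morphism X Y := Morphism {
  mfun :> X -> Y;
  mfun_strict : strictly_continuous mfun;
  mfun_sec : forall (V : set Y) (h : V -> M), gop V ->
    space_sheaf Y V h -> space_sheaf X (mfun @^-1` V) (pullback mfun h) }.

Lemma morphism_eq X Y (f g : morphism X Y) : mfun f = mfun g -> f = g.
Proof.
case: f g => f f1 f2 [g g1 g2] /= fg; subst g.
by rewrite (Prop_irrelevance f1 g1) (Prop_irrelevance f2 g2).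
Qed.

Lemma id_strict X : strictly_continuous (@id X).
Proof. by move=> U; rewrite (_ : [set _ | _ in _] = U) // image_id. Qed.

Lemma id_sec X (V : set X) (h : V -> M) :
  gop V -> space_sheaf X V h -> space_sheaf X V (pullback id h).
Proof.
move=> _; suff -> : pullback id h = h by [].
by apply/funext => x; congr h; exact: val_inj.
Qed.

Lemma comp_strict X Y Z (g : morphism Y Z) (f : morphism X Y) :
  strictly_continuous (g \o f).
Proof.
move=> U /(mfun_strict g)/(mfun_strict f).
by rewrite image_comp.
Qed.

Lemma comp_sec X Y Z (g : morphism Y Z) (f : morphism X Y)
    (V : set Z) (h : V -> M) :
  gop V -> space_sheaf Z V h -> space_sheaf X _ (pullback (g \o f) h).
Proof.
move=> oV /(@mfun_sec _ _ g _ _ oV).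
move=> /(@mfun_sec _ _ f _ _ (preimage_gop (@mfun_strict _ _ g) oV)).
suff -> : pullback f (pullback g h) = pullback (g \o f) h by [].
by apply/funext => x; congr h; exact: val_inj.
Qed.

Definition id_morphism X : morphism X X :=
  Morphism (@id_strict X) (@id_sec X).

Definition comp_morphism X Y Z (g : morphism Y Z) (f : morphism X Y) :
  morphism X Z := Morphism (comp_strict g f) (@comp_sec X Y Z g f).

Definition space_category : category.
Proof.
refine (@Category (space M) morphism id_morphism comp_morphism _ _ _).
- by move=> X Y f; exact: morphism_eq.
- by move=> X Y f; exact: morphism_eq.
- by move=> W X Y Z h g f; exact: morphism_eq.
Defined.

End SpaceCategory.

(** * Open subspaces *)

Section OpenSubspace.
Context (M : Type) (X : space M) (U : set X) (oU : gop U).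

Definition sub_op : set (set U) := [set W | gop (val @` W)].

Definition sub_cov : set (set (set U)) :=
  [set F | gcov [set val @` W | W in F]].

(* f : W -> M seen as a function on the subset val @` W of X *)
Definition sub_sec (W : set U) : set (W -> M) :=
  [set f | exists2 g : set_type (val @` W) -> M, space_sheaf X (val @` W) g &
     f = g \o smap (@preimage_image U X val W)].

Let imI (A B : set U) : val @` (A `&` B) = val @` A `&` val @` B.
Proof.
apply/seteqP; split=> x; first by move=> [y [Ay By] <-]; split; exists y.
by move=> [[y Ay <-]] [z Bz] /val_inj zy; exists y => //; split => //; rewrite -zy.
Qed.

Let imU (F : set (set U)) :
  val @` (\bigcup_(A in F) A) = \bigcup_(A in [set val @` W | W in F]) A :> set X.
Proof. by rewrite image_bigcup bigcup_image. Qed.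

Let famE (V : set U) F :
  [set val @` W | W in famI V F] = famI (val @` V) [set val @` W | W in F].
Proof.
by rewrite /famI !image_comp; apply: eq_imagel => W _ /=; rewrite imI.
Qed.

Lemma sub_cov_op F : sub_cov F -> F `<=` sub_op.
Proof. by move=> /gcov_gop cF W FW; apply: cF; exists W. Qed.

Lemma sub_finite F : finite_set F -> F `<=` sub_op ->
  [/\ sub_op (\bigcup_(A in F) A), sub_op (\bigcap_(A in F) A) & sub_cov F].
Proof.
move=> finF oF; have [||o1 o2 c] := @gts_finite X [set val @` W | W in F].
- exact: finite_image.
- by move=> _ [W FW <-]; exact: oF.
split=> //; first by rewrite /sub_op /= imU.
rewrite /sub_op /=; have -> : val @` (\bigcap_(A in F) A) =
    U `&` \bigcap_(A in [set val @` W | W in F]) A; last exact: gopI.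
apply/seteqP; split=> x.
  move=> [y Fy <-]; split; first exact: set_valP.
  by move=> _ [W FW <-]; exists y => //; exact: Fy.
move=> [Ux Fx]; exists (exist _ x (mem_set Ux)) => // W FW.
have [|y Wy yx] := Fx (val @` W); first by exists W.
by rewrite (_ : exist _ _ _ = y) //; exact: val_inj.
Qed.

Lemma sub_stable V F : sub_op V -> sub_cov F -> sub_cov (famI V F).
Proof. by move=> oV cF; rewrite /sub_cov /= famE; exact: gts_stable. Qed.

Lemma sub_trans (Phi : set (set (set U))) : Phi `<=` sub_cov ->
  sub_cov [set \bigcup_(A in F) A | F in Phi] -> sub_cov (\bigcup_(F in Phi) F).
Proof.
move=> cPhi; rewrite /sub_cov /= [in X in _ -> X]image_bigcup => c.
have := bigcup_image Phi (fun F => [set val @` W | W in F]) (@id (set (set X))).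
move=> /= <-; apply: gts_trans; first by move=> _ [F /cPhi ? <-].
move: c; rewrite /sub_cov /= !image_comp.
by congr gcov; apply: eq_imagel => F _ /=; rewrite imU.
Qed.

Lemma sub_saturated F G : sub_cov F -> G `<=` sub_op -> finer F G -> sub_cov G.
Proof.
move=> cF oG [FG1 FG2]; apply: gts_saturated cF _ _.
  by move=> _ [W GW <-]; exact: oG.
split; first by rewrite -!imU FG1.
move=> _ [A FA <-]; have [B GB AB] := FG2 _ FA.
by exists (val @` B); [exists B|exact: image_subset].
Qed.

Lemma sub_regular W F : sub_cov F -> famI W F `<=` sub_op ->
  sub_op (W `&` \bigcup_(A in F) A).
Proof.
move=> cF oWF; rewrite /sub_op /= imI imU; apply: gts_regular => //.
by rewrite -famE => _ [A WFA <-]; exact: oWF.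
Qed.

Definition sub_gts : gts :=
  Gts sub_cov_op sub_finite sub_stable sub_trans sub_saturated sub_regular.

Let lft (W : set U) (f : W -> M) : exists g : set_type (val @` W) -> M,
  f = g \o smap (@preimage_image U X val W).
Proof.
have inv (y : set_type (val @` W)) : exists x : W, val (val x) = val y.
  have [x Wx xy] := set_valP y.
  by exists (exist _ x (mem_set Wx)).
exists (fun y => f (sval (cid (inv y)))).
apply/funext => x /=; congr f; case: cid => z /= zx.
by apply/esym/val_inj/val_inj.
Qed.

Let lft_inj (W : set U) (g h : set_type (val @` W) -> M) :
  g \o smap (@preimage_image U X val W) = h \o smap (@preimage_image U X val W) ->
  g = h.
Proof.
move=> gh; apply/funext => y; have [x Wx xy] := set_valP y.
have := congr1 (@^~ (exist _ x (mem_set Wx))) gh; rewrite /=.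
by have -> : smap (@preimage_image U X val W) (exist _ x (mem_set Wx)) = y
  by exact: val_inj.
Qed.

Lemma sub_sec_restr (A B : set sub_gts) (BA : B `<=` A) : gop A -> gop B ->
  forall f, @sub_sec A f -> @sub_sec B (restr BA f).
Proof.
move=> oA oB _ [g Gg ->].
exists (restr (@image_subset _ _ val _ _ BA) g).
  exact: (@sec_restr _ _ (space_sheaf X) _ _ _ (oA : gop (val @` A))
    (oB : gop (val @` B)) g Gg).
by apply/funext => x; congr g; exact: val_inj.
Qed.

Lemma sub_sec_glue (F : set (set sub_gts)) (f : \bigcup_(A in F) A -> M) :
  gcov F ->
  (forall (A : set sub_gts) (AF : A `<=` \bigcup_(A in F) A),
    F A -> sub_sec (restr AF f)) -> sub_sec f.
Proof.
move=> cF Ff; have [g fg] := lft f; exists g => //.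
have {fg} : forall x (y : set_type (val @` (\bigcup_(A in F) A))),
    val y = val (val x) -> f x = g y.
  by move=> x y yx; rewrite fg /=; congr g; exact: val_inj.
move: g; rewrite imU => g fg.
apply: sec_local => // _ /[swap] -[A FA <-] AU.
have AF : A `<=` \bigcup_(A in F) A by move=> x Ax; exists A.
have [h Gh Eh] := Ff A AF FA.
suff -> : restr AU g = h by [].
apply: lft_inj; rewrite -Eh.
by apply/funext => x; rewrite /restr /=; exact/esym/fg.
Qed.

Definition sub_sheaf : function_sheaf M sub_gts :=
  FunctionSheaf sub_sec_restr (glue_functions sub_sec_glue).

Definition open_subspace : space M := Space sub_sheaf.

End OpenSubspace.

(** * Definable sets as spaces *)

Section EssentiallyFinite.
Context (T : Type) (op : set (set T)).
Hypothesis op_finite : forall U, finite_set U -> U `<=` op ->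
  op (\bigcup_(A in U) A) /\ op (\bigcap_(A in U) A).

Definition ef_cov : set (set (set T)) :=
  [set U | U `<=` op /\ essentially_finite U].

Lemma ef_cov_op U : ef_cov U -> U `<=` op.
Proof. by case. Qed.

Lemma ef_finite U : finite_set U -> U `<=` op ->
  [/\ op (\bigcup_(A in U) A), op (\bigcap_(A in U) A) & ef_cov U].
Proof.
move=> finU oU; have [? ?] := op_finite finU oU.
by split=> //; split=> //; exists U; split.
Qed.

Let opI A B : op A -> op B -> op (A `&` B).
Proof.
move=> oA oB; have [|_ +] := @op_finite [set A; B] (finite_set2 A B).
  by move=> _ [->|->].
by rewrite bigcap_setU !bigcap_set1.
Qed.

Let bigcup_famI V (U : set (set T)) :
  \bigcup_(A in famI V U) A = V `&` \bigcup_(A in U) A.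
Proof. by rewrite setI_bigcupr bigcup_image. Qed.

Lemma ef_stable V U : op V -> ef_cov U -> ef_cov (famI V U).
Proof.
move=> oV [oU [F [finF FU FE]]]; split.
  by move=> _ [A UA <-]; apply: opI => //; exact: oU.
exists (famI V F); split; first exact: finite_image.
  exact: image_subset.
by rewrite !bigcup_famI FE.
Qed.

Lemma ef_trans (Phi : set (set (set T))) : Phi `<=` ef_cov ->
  ef_cov [set \bigcup_(A in U) A | U in Phi] -> ef_cov (\bigcup_(U in Phi) U).
Proof.
move=> cPhi [_ [F [finF FPhi FE]]]; split.
  by move=> A [U /cPhi [oU _] UA]; exact: oU.
have ex (B : set T) : exists V : set (set T),
    F B -> [/\ finite_set V, V `<=` \bigcup_(U in Phi) U & \bigcup_(A in V) A = B].
  have [FB|nFB] := pselect (F B); last by exists set0.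
  have [U PU <-] := FPhi _ FB; have [_ [V [finV VU VE]]] := cPhi _ PU.
  by exists V => _; split=> // A /VU UA; exists U.
pose v B := sval (cid (ex B)).
have vP B : F B ->
    [/\ finite_set (v B), v B `<=` \bigcup_(U in Phi) U & \bigcup_(A in v B) A = B].
  exact: (svalP (cid (ex B))).
exists (\bigcup_(B in F) v B); split.
- by apply: bigcup_finite => // B /vP [].
- by move=> A [B /vP [_ + _]]; exact.
apply/seteqP; split=> x.
  by move=> [A [B /vP [_ h _] /h PA] Ax]; exists A.
move=> [A [U PU UA] Ax].
have : (\bigcup_(B in F) B) x.
  by rewrite FE; exists (\bigcup_(A in U) A); [exists U|exists A].
move=> [B FB Bx]; have [_ _ vB] := vP _ FB.
by move: Bx; rewrite -vB => -[C vC Cx]; exists C => //; exists B.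
Qed.

Lemma ef_saturated U V : ef_cov U -> V `<=` op -> finer U V -> ef_cov V.
Proof.
move=> [oU [F [finF FU FE]]] oV [UV1 UV2]; split=> //.
have ex (A : set T) : exists B, F A -> V B /\ A `<=` B.
  have [FA|nFA] := pselect (F A); last by exists set0.
  by have [B VB AB] := UV2 _ (FU _ FA); exists B.
pose v A := sval (cid (ex A)).
have vP A : F A -> V (v A) /\ A `<=` v A by exact: (svalP (cid (ex A))).
exists (v @` F); split; first exact: finite_image.
  by move=> _ [A /vP [? _] <-].
apply/seteqP; split=> x.
  by move=> [_ [A /vP [VA _] <-] Ax]; exists (v A).
rewrite -UV1 -FE => -[A FA Ax]; exists (v A); first by exists A.
by have [_] := vP _ FA; exact.
Qed.

Lemma ef_regular W U : ef_cov U -> famI W U `<=` op ->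
  op (W `&` \bigcup_(A in U) A).
Proof.
move=> [oU [F [finF FU <-]]] oWU; rewrite -bigcup_famI.
have [||//] := @op_finite (famI W F); first exact: finite_image.
by move=> A [B FB <-]; apply: oWU; exists B => //; exact: FU.
Qed.

Definition ef_gts : gts :=
  Gts ef_cov_op ef_finite ef_stable ef_trans ef_saturated ef_regular.

End EssentiallyFinite.

Section DefinableSpace.
Context {L : signature} (M : wt_structure L).
Context (n : nat) (D : set {ptws 'I_n -> M}) (dD : definable D).

(* D and its subsets carry the subspace topology. *)
Definition def_op : set (set D) :=
  [set U : set D | open U /\ definable (val @` U)].

Definition graph (U : set D) (f : U -> M) : set {ptws 'I_n.+1 -> M} :=
  [set snoc (val (val x)) (f x) | x in [set: U]].

Definition def_sec (U : set D) : set (U -> M) :=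
  [set f | continuous f /\ definable (graph f)].

Lemma def_op_finite F : finite_set F -> F `<=` def_op ->
  def_op (\bigcup_(A in F) A) /\ def_op (\bigcap_(A in F) A).
Proof.
move=> finF oF; split; split.
- by apply: bigcup_open => A /oF [].
- by rewrite image_bigcup; apply: definable_bigcup => // A /oF [].
- rewrite -bigsetI_fset_set // big_seq.
  elim/big_ind: _ => [|A B|A]; [exact: openT|exact: openI|].
  by rewrite in_fset_set // inE => /oF [].
- suff -> : val @` (\bigcap_(A in F) A) =
      D `&` ~` (\bigcup_(A in F) (D `&` ~` (val @` A))).
    apply: definableI => //; apply: definableC.
    apply: definable_bigcup => // A /oF [_ dA].
    by apply: definableI => //; exact: definableC.
  apply/seteqP; split=> x.
    move=> [y Fy <-]; split; first exact: set_valP.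
    by move=> [A FA [_]]; apply; exists y => //; exact: Fy.
  move=> [Dx nFx]; exists (exist _ x (mem_set Dx)) => // A FA.
  apply: contrapT => nAx; apply: nFx; exists A => //; split=> // -[y Ay yx].
  by apply: nAx; rewrite (_ : exist _ _ _ = y) //; exact: val_inj.
Qed.

Definition def_gts : gts := ef_gts def_op_finite.

Let graph_restr (U V : set D) (VU : V `<=` U) (f : U -> M) :
  graph (restr VU f) =
  graph f `&` [set z : {ptws 'I_n.+1 -> M} | (val @` V) (z \o lift ord_max : {ptws 'I_n -> M})].
Proof.
apply/seteqP; split=> z.
  move=> [x _ <-]; split; first by exists (smap VU x).
  by rewrite /= snoc_lift; exists (val x) => //; exact: set_valP.
move=> [[x _ <-]]; rewrite /= snoc_lift => -[y Vy /val_inj yx].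
have Vx : V (val x) by move: Vy; rewrite yx.
exists (exist _ (val x) (mem_set Vx)) => //.
by rewrite /restr /=; congr (snoc _ (f _)); exact: val_inj.
Qed.

Lemma def_sec_restr (U V : set def_gts) (VU : V `<=` U) : gop U -> gop V ->
  forall f, @def_sec U f -> @def_sec V (restr VU f).
Proof.
move=> _ [oV dV] f [cf df]; split; last first.
  by rewrite graph_restr; apply: definableI => //; exact: definable_preim.
apply/continuousP => B oB.
have /continuousP/(_ B oB) [A oA AE] := cf.
exists A => //; apply/seteqP; split=> x /=.
  move=> Ax; suff : (f @^-1` B) (smap VU x) by [].
  by rewrite -AE.
by move=> Bx; have : (f @^-1` B) (smap VU x) by []; rewrite -AE.
Qed.

Lemma def_sec_glue (F : set (set def_gts)) (f : \bigcup_(A in F) A -> M) :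
  gcov F ->
  (forall (A : set def_gts) (AF : A `<=` \bigcup_(A in F) A),
    F A -> def_sec (restr AF f)) -> def_sec f.
Proof.
move=> [oF [G [finG GF GE]]] Ff.
have AF (A : set D) : F A -> A `<=` \bigcup_(A in F) A.
  by move=> FA x Ax; exists A.
split; last first.
  suff -> : graph f = \bigcup_(A in G)
      (graph f `&` [set z : {ptws 'I_n.+1 -> M} | (val @` A) (z \o lift ord_max : {ptws 'I_n -> M})]).
    apply: definable_bigcup => // A /GF FA; rewrite -(graph_restr (AF A FA)).
    by have [] := Ff A (AF A FA) FA.
  apply/seteqP; split=> z; last by move=> [A _ []].
  move=> fz; have [x _ xz] := fz.
  have : (\bigcup_(A in G) A) (val x) by rewrite GE; exact: set_valP.
  move=> [A GA Ax]; exists A => //; split=> //.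
  by rewrite -xz /= snoc_lift; exists (val x).
apply/continuousP => B oB.
have ex (A : set D) : exists O : set D, F A -> open O /\
    forall x : \bigcup_(A in F) A, A (val x) -> (B (f x) <-> O (val x)).
  have [FA|nFA] := pselect (F A); last by exists set0.
  have [/continuousP/(_ B oB) [O oO OE] _] := Ff A (AF A FA) FA.
  exists O => _; split=> // x Ax.
  pose y : A := exist _ (val x) (mem_set Ax).
  have yx : smap (AF A FA) y = x by exact: val_inj.
  have := congr1 (@^~ y) OE; rewrite /preimage /mkset /restr /= yx => <-.
  by [].
pose O A := sval (cid (ex A)).
have OP A : F A -> open (O A) /\
    forall x : \bigcup_(A in F) A, A (val x) -> (B (f x) <-> O A (val x)).
  exact: (svalP (cid (ex A))).
exists (\bigcup_(A in F) (A `&` O A)).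
  apply: bigcup_open => A FA; apply: openI; last by have [] := OP A FA.
  by have [] := oF A FA.
apply/seteqP; split=> x.
  by move=> [A FA [Ax Ox]]; have [_ h] := OP A FA; exact/(h x Ax).
move=> Bx; have [A FA Ax] := set_valP x; exists A => //; split=> //.
by have [_ h] := OP A FA; exact/(h x Ax).
Qed.

Definition def_sheaf : function_sheaf M def_gts :=
  FunctionSheaf def_sec_restr (glue_functions def_sec_glue).

Definition definable_space : space M := Space def_sheaf.

End DefinableSpace.

(** * Locally definable spaces *)

Definition affine_definable {L : signature} (M : wt_structure L)
    (X : space M) : Prop :=
  exists (n : nat) (D : set {ptws 'I_n -> M}) (dD : definable D),
    @isomorphic (space_category M) X (definable_space dD).

Definition locally_definable {L : signature} (M : wt_structure L)
    (X : space M) : Prop :=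
  exists U : set (set X), [/\ gcov U, \bigcup_(A in U) A = [set: X] &
    forall (A : set X) (oA : gop A), U A -> affine_definable (open_subspace oA)].

Definition LDS {L : signature} (M : wt_structure L) : category :=
  @full_subcategory (space_category M) (@locally_definable L M).

(* Main.v *)
From mathcomp Require Import all_boot.
From mathcomp Require Import boolp classical_sets functions cardinality topology.
Require Import Defs.

(** The limit of a finite diagram of locally definable spaces X_j is the set T
of compatible families of points, with the structure that the spaces X_j force
on it; the point is that T is again covered by definable sets.

Choose for each X_j a chart, that is a definable set D_j with an open embedding
into X_j.  The families whose j-th entry lies in the image of D_j, for every j,
correspond to the points of a subset of the product of the D_j, which sits in a
power of M.  This subset is definable: an arrow of the diagram, read in two
charts, is a morphism from a definable open part of one definable set to another
definable set, the coordinates of such a morphism are sections and hence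
have definable graphs ([transition_definable]), and the diagram has finitely
many arrows ([limit_joint_dom_definable]).  So the subset is a definable space,
and these definable spaces, one for each choice of charts, overlap in open
pieces.  They are glued along the overlaps: T receives the final structure for
their maps to T, and under the overlap condition these maps become open
embeddings whose images form an admissible covering ([glue_map_oemb],
[glue_map_cover]).  So T is locally definable.

The universal property rests on two facts.  First, being a morphism can be
tested on an admissible covering of the source ([morphism_local]), so maps from
a locally definable space to T are controlled by maps from definable sets.
Second, a map between definable sets is a morphism as soon as its coordinates
are sections ([map_morphism]), so a map from a definable set to T whose components
in the X_j each stay in one chart is a morphism if its components are
([joint_lift]).  The general map from a definable set is cut into maps of this
kind by pulling back the atlases of the X_j, one j after the other
([initial_affine]).

The universal property is tested against locally definable spaces only.  In the
category of all spaces T need not be a limit: a relatively open definable subset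
of an equalizer need not be the trace of an open definable set. *)

Set Implicit Arguments.
Unset Strict Implicit.
Unset Printing Implicit Defensive.

Local Open Scope classical_set_scope.

(** * Admissible coverings *)

Section GtsCovers.
Context (X : gts).
Implicit Types (U V W : set X) (C F : set (set X)).

Lemma bigcup_famI V F : \bigcup_(A in famI V F) A = V `&` \bigcup_(A in F) A.
Proof. by rewrite setI_bigcupr bigcup_image. Qed.

Lemma gcov_essentially_finite F :
  F `<=` gop -> essentially_finite F -> gcov F.
Proof.
move=> oF [G [finG GF GE]].
have [_ _ cG] := gts_finite finG (subset_trans GF oF).
apply: gts_saturated cG oF _; split=> // A GA.
by exists A => //; exact: GF.
Qed.

Lemma gcov_set1 W : gop W -> gcov [set W].
Proof.
move=> oW; have [|//] := @gts_finite X [set W] (finite_set1 W).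
by move=> _ ->.
Qed.

Lemma gcov_setT F : F `<=` gop -> F setT -> gcov F.
Proof.
move=> oF FT; apply: gcov_essentially_finite => //.
exists [set setT]; split; [exact: finite_set1|by move=> _ ->|].
by rewrite bigcup_set1; apply/seteqP; split=> // x _; exists setT.
Qed.

(** Regularity turns openness into a local property. *)
Lemma gop_local C W : gcov C -> \bigcup_(A in C) A = setT ->
  (forall B, C B -> gop (W `&` B)) -> gop W.
Proof.
move=> cC CT oW; rewrite -[W]setIT -CT; apply: gts_regular => //.
by move=> _ [B CB <-]; exact: oW.
Qed.

(** The traces of F on the members of C are admissible, hence so is their
union, by transitivity applied along the covering of the union of F by its
traces; F is coarser than that family, so saturation applies. *)
Lemma gcov_local C F : gcov C -> \bigcup_(A in C) A = setT ->
  (forall B, C B -> gcov (famI B F)) -> gcov F.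
Proof.
move=> cC CT cF.
have oF : F `<=` gop.
  move=> A FA; apply: gop_local cC CT _ => B CB; rewrite setIC.
  by apply: (gcov_gop (cF B CB)); exists A.
have oUF : gop (\bigcup_(A in F) A).
  apply: gop_local cC CT _ => B CB; rewrite setIC -bigcup_famI.
  exact/gop_bigcup/cF.
(* The unions of the traces are the traces of the union of F on the members of
   C, an admissible family by stability. *)
have c : gcov (\bigcup_(G in [set famI B F | B in C]) G).
  apply: gts_trans; first by move=> _ [B CB <-]; exact: cF.
  have -> : [set \bigcup_(A in G) A | G in [set famI B F | B in C]] =
      famI (\bigcup_(A in F) A) C; last exact: gts_stable.
  rewrite /famI image_comp; apply: eq_imagel => B _ /=.
  by rewrite bigcup_famI setIC.
apply: gts_saturated c oF _; split.
  apply/seteqP; split=> x.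
    by move=> [_ [_ [B CB <-] [A FA <-]] [_ Ax]]; exists A.
  move=> [A FA Ax]; have : (\bigcup_(A in C) A) x by rewrite CT.
  move=> [B CB Bx]; exists (B `&` A) => //.
  by exists (famI B F); [exists B|exists A].
by move=> _ [_ [B CB <-] [A FA <-]]; exists A => // x [].
Qed.

End GtsCovers.

Section Sheaves.
Context (M : Type) (X : gts) (G : function_sheaf M X).

(** Sections over sets that are equal but not convertible: the comparison is
made on points, so that no cast along the equality appears. *)
Lemma sec_congr (U V : set X) (f : U -> M) (g : V -> M) : U = V ->
  (forall x y, val x = val y -> f x = g y) -> G U f -> G V g.
Proof.
move=> UV; case: V / UV g => g fg.
by have -> : f = g by apply/funext => x; exact: fg.
Qed.

Lemma sec_cover (C : set (set X)) (W : set X) (f : W -> M) : gcov C ->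
  W = \bigcup_(A in C) A ->
  (forall (A : set X) (AW : A `<=` W), C A -> G A (restr AW f)) -> G W f.
Proof. by move=> cC WE; subst W; exact: sec_local. Qed.

End Sheaves.

(** * Open embeddings *)

Section OpenEmbeddings.
Context (M : Type).
Implicit Types X Y Z : space M.

(** The last condition is stated for a function h on the image because sections
are indexed by sets; every function on W is such an h composed with j, as j is
injective ([push_fun]). *)
Record open_embedding (Y X : space M) (j : Y -> X) : Prop := OpenEmbedding {
  oemb_inj : injective j;
  oemb_cov : forall F : set (set Y), gcov F -> gcov [set j @` A | A in F];
  oemb_sec : forall (W : set Y) (h : set_type (j @` W) -> M), gop W ->
    space_sheaf Y W (h \o smap (@preimage_image Y X j W)) ->
    space_sheaf X (j @` W) h }.

Lemma oemb_open (Y X : space M) (j : Y -> X) (W : set Y) :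
  open_embedding j -> gop W -> gop (j @` W).
Proof.
move=> jo /gcov_set1/(oemb_cov jo)/gcov_gop; apply.
by exists W.
Qed.

Lemma oemb_range (Y X : space M) (j : Y -> X) :
  open_embedding j -> gop (range j).
Proof. by move=> jo; apply: oemb_open jo _; exact: gopT. Qed.

Lemma push_fun (Y X T : Type) (j : Y -> X) (W : set Y) (h : W -> T) :
  injective j -> exists g : set_type (j @` W) -> T,
    forall (x : W) (y : set_type (j @` W)), val y = j (val x) -> g y = h x.
Proof.
move=> jI; have ex (y : set_type (j @` W)) : exists x : W, j (val x) = val y.
  have [x Wx xy] := set_valP y.
  by exists (exist _ x (mem_set Wx)).
exists (fun y => h (sval (cid (ex y)))) => x y yx.
case: cid => z /= zy; congr h; apply: val_inj; apply: jI.
by rewrite zy yx.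
Qed.

(** As j is injective and covers the image of f, preimages under g are
preimages under f of images under j, and both the families and the sections of
Y are carried to X by j. *)
Lemma oemb_factor X Y Z (j : morphism Y X) (f : morphism Z X) :
  open_embedding j -> (forall z, range j (f z)) ->
  exists g : morphism Z Y, forall z, j (g z) = f z.
Proof.
move=> jo fj.
have /choice[g gE] : forall z, exists y, j y = f z.
  by move=> z; have [y _ <-] := fj z; exists y.
have pre (A : set Y) : g @^-1` A = f @^-1` (j @` A).
  apply/seteqP; split=> z /=; first by exists (g z).
  by move=> [y Ay]; rewrite -gE => /(oemb_inj jo) <-.
have gs : strictly_continuous g.
  move=> F /(oemb_cov jo)/(mfun_strict f); rewrite image_comp.
  by congr gcov; apply: eq_imagel => A _ /=; rewrite pre.
suff gf : forall (V : set Y) (h : V -> M), gop V -> space_sheaf Y V h ->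
    space_sheaf Z (g @^-1` V) (pullback (f := g) h).
  by exists (Morphism gs gf).
move=> V h oV hV; have [h' h'E] := push_fun h (oemb_inj jo).
have : space_sheaf X (j @` V) h'.
  apply: (oemb_sec jo) => //; congr (space_sheaf _ _ _): hV.
  by apply/funext => x /=; apply/esym/h'E.
move=> /(@mfun_sec _ _ _ f _ _ (oemb_open jo oV)).
apply: sec_congr; first by rewrite pre.
move=> x y xy; rewrite /pullback /=; apply: h'E => /=.
by rewrite gE xy.
Qed.

Lemma oemb_comp X Y Z (j : morphism Y X) (i : morphism Z Y) :
  open_embedding j -> open_embedding i -> open_embedding (comp_morphism j i).
Proof.
move=> jo io; split.
- exact: inj_comp (oemb_inj jo) (oemb_inj io).
- move=> F /(oemb_cov io)/(oemb_cov jo); rewrite image_comp.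
  by congr gcov; apply: eq_imagel => A _ /=; rewrite image_comp.
move=> W h oW hW.
have iW : (j \o i) @` W = j @` (i @` W) by rewrite image_comp.
have inc : j @` (i @` W) `<=` (j \o i) @` W by rewrite iW.
have : space_sheaf X (j @` (i @` W)) (restr inc h).
  apply: (oemb_sec jo); first exact: oemb_open.
  apply: (oemb_sec io) => //; congr (space_sheaf _ _ _): hW.
  by apply/funext => x /=; congr h; exact: val_inj.
by apply: sec_congr => // x y xy; congr h; exact: val_inj.
Qed.

Lemma oemb_iso X Y (j : morphism Y X) (i : morphism X Y) :
  (forall y, i (j y) = y) -> (forall x, j (i x) = x) -> open_embedding j.
Proof.
move=> ij ji.
have im (A : set Y) : j @` A = i @^-1` A.
  apply/seteqP; split=> x /=; first by move=> [y Ay <-]; rewrite ij.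
  by move=> Ax; exists (i x).
split; first exact: can_inj ij.
  move=> F /(mfun_strict i); congr gcov.
  by apply: eq_imagel => A _; rewrite im.
move=> W h oW /(@mfun_sec _ _ _ i _ _ oW).
apply: sec_congr; first by rewrite im.
move=> x y xy; rewrite /pullback /=; congr h; apply: val_inj => /=.
by rewrite ji.
Qed.

Section Inclusion.
Context (X : space M) (U : set X) (oU : gop U).
Local Notation S := (open_subspace oU).

Lemma incl_strict : strictly_continuous (val : S -> X).
Proof.
move=> F cF; rewrite /gcov /= /sub_cov /= image_comp.
have := gts_stable oU cF; congr gcov.
rewrite /famI; apply: eq_imagel => A _ /=; apply/seteqP; split=> x.
  move=> [Ux Ax]; by exists (exist _ x (mem_set Ux)).
by move=> [y Ay <-]; split => //; exact: set_valP.
Qed.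

Lemma incl_sec (V : set X) (h : V -> M) : gop V -> space_sheaf X V h ->
  space_sheaf S ((val : S -> X) @^-1` V) (pullback (f := (val : S -> X)) h).
Proof.
move=> oV hV.
have inc : (val : S -> X) @` ((val : S -> X) @^-1` V) `<=` V.
  by move=> _ [y Vy <-].
have o : gop ((val : S -> X) @` ((val : S -> X) @^-1` V)).
  exact: (preimage_gop incl_strict oV).
exists (restr inc h).
  exact: (@sec_restr _ _ (space_sheaf X) _ _ inc oV o h hV).
by apply/funext => x; congr h; exact: val_inj.
Qed.

Definition inclusion : morphism S X := Morphism incl_strict incl_sec.

Lemma inclusion_oemb : open_embedding inclusion.
Proof.
split; [exact: val_inj|by []|].
move=> W h oW [g gW hg]; suff -> : h = g by [].
apply/funext => y; have [x Wx xy] := set_valP y.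
have := congr1 (@^~ (exist _ x (mem_set Wx))) hg.
congr (h _ = g _); exact: val_inj.
Qed.

Lemma inclusion_range : range inclusion = U.
Proof.
apply/seteqP; split=> x; first by move=> [y _ <-]; exact: set_valP.
by move=> Ux; exists (exist _ x (mem_set Ux)).
Qed.

End Inclusion.

(** Two open embeddings with the same image factor through each other. *)
Lemma oemb_isomorphic X Y (j : morphism Y X) (A : set X) (oA : gop A) :
  open_embedding j -> range j = A ->
  @isomorphic (space_category M) (open_subspace oA) Y.
Proof.
move=> jo jA; pose i := inclusion oA; have io := inclusion_oemb oA.
have [|f fE] := oemb_factor (f := i) jo.
  by move=> z; rewrite jA; exact: set_valP.
have [|g gE] := oemb_factor (f := j) io.
  by move=> z; rewrite inclusion_range -jA; exists z.
exists f, g; split; apply: morphism_eq; apply/funext => x /=.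
  by apply: (oemb_inj io); rewrite gE fE.
by apply: (oemb_inj jo); rewrite fE gE.
Qed.

(** Preimages under f are traced on the images of the j i, where they are
images of preimages under g i; [gcov_local] and the sheaf property put them
together. *)
Lemma morphism_local X Z (I : Type) (Y : I -> space M)
    (j : forall i, morphism (Y i) X) (f : X -> Z)
    (g : forall i, morphism (Y i) Z) :
  (forall i, open_embedding (j i)) -> gcov (range (fun i => range (j i))) ->
  (forall x, exists i, range (j i) x) -> (forall i y, f (j i y) = g i y) ->
  exists f' : morphism X Z, mfun f' = f.
Proof.
move=> jo jc jT fE.
have cT : \bigcup_(A in range (fun i => range (j i))) A = setT.
  rewrite bigcup_image; apply/seteqP; split=> // x _.
  by have [i jx] := jT x; exists i.
have pre i (A : set Z) : range (j i) `&` f @^-1` A = j i @` (g i @^-1` A).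
  apply/seteqP; split=> x.
    by move=> [[y _ <-]] /=; rewrite fE; exists y.
  by move=> [y /= Ay <-]; split; [exists y|rewrite /= fE].
have fs : strictly_continuous f.
  move=> F cF; apply: gcov_local jc cT _ => _ [i _ <-].
  have := oemb_cov (jo i) (mfun_strict (g i) cF); congr gcov.
  by rewrite /famI !image_comp; apply: eq_imagel => A _ /=; rewrite pre.
suff ff : forall (V : set Z) (h : V -> M), gop V -> space_sheaf Z V h ->
    space_sheaf X (f @^-1` V) (pullback (f := f) h).
  by exists (Morphism fs ff).
move=> V h oV hV.
apply: (@sec_cover _ _ _ (famI (f @^-1` V) (range (fun i => range (j i))))).
- by apply: gts_stable jc; exact: preimage_gop.
- by rewrite bigcup_famI cT setIT.
move=> _ /[swap] -[_ [i _ <-] <-] AV.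
(* Over the image of j i, the function is pulled back along g i. *)
have inc : j i @` (g i @^-1` V) `<=` f @^-1` V.
  by rewrite -pre => x [].
have : space_sheaf X _ (restr inc (pullback (f := f) h)).
  have ogV := preimage_gop (@mfun_strict _ _ _ (g i)) oV.
  apply: (oemb_sec (jo i)) => //.
  have := @mfun_sec _ _ _ (g i) _ _ oV hV; congr (space_sheaf _ _ _).
  by apply/funext => x; congr h; apply: val_inj => /=; rewrite fE.
apply: sec_congr; first by rewrite setIC pre.
by move=> x y xy; congr h; apply: val_inj => /=; rewrite xy.
Qed.

End OpenEmbeddings.

(** * Gluing spaces along open overlaps *)

(** The final structure on T for the maps psi i : Y i -> T. The conditions on
overlaps stated after its construction make it a gluing, in which each Y i is
an open subspace. *)
Section Gluing.
Context (M : Type) (I : Type) (Y : I -> space M) (T : Type).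
Context (psi : forall i, Y i -> T).
Arguments psi : clear implicits.

Definition glue_op : set (set T) :=
  [set W | forall i, gop (psi i @^-1` W)].

Definition glue_cov : set (set (set T)) :=
  [set F | forall i, gcov [set psi i @^-1` A | A in F]].

Let pre_bigcup i (F : set (set T)) : psi i @^-1` (\bigcup_(A in F) A) =
  \bigcup_(A in [set psi i @^-1` A | A in F]) A.
Proof. by rewrite preimage_bigcup bigcup_image. Qed.

Let pre_famI i V (F : set (set T)) :
  [set psi i @^-1` A | A in famI V F] =
  famI (psi i @^-1` V) [set psi i @^-1` A | A in F].
Proof. by rewrite /famI !image_comp; apply: eq_imagel. Qed.

Lemma glue_cov_op F : glue_cov F -> F `<=` glue_op.
Proof. by move=> cF A FA i; apply: (gcov_gop (cF i)); exists A. Qed.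

Lemma glue_finite F : finite_set F -> F `<=` glue_op ->
  [/\ glue_op (\bigcup_(A in F) A), glue_op (\bigcap_(A in F) A) & glue_cov F].
Proof.
move=> finF oF.
have h i : [/\ gop (\bigcup_(A in [set psi i @^-1` A | A in F]) A),
    gop (\bigcap_(A in [set psi i @^-1` A | A in F]) A) &
    gcov [set psi i @^-1` A | A in F]].
  apply: gts_finite; first exact: finite_image.
  by move=> _ [A FA <-]; exact: oF.
split=> i; have [h1 h2 h3] := h i => //; first by rewrite pre_bigcup.
by rewrite preimage_bigcap; rewrite bigcap_image in h2.
Qed.

Lemma glue_stable V F : glue_op V -> glue_cov F -> glue_cov (famI V F).
Proof. by move=> oV cF i; rewrite pre_famI; exact: gts_stable. Qed.

Lemma glue_trans (Phi : set (set (set T))) : Phi `<=` glue_cov ->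
  glue_cov [set \bigcup_(A in F) A | F in Phi] ->
  glue_cov (\bigcup_(F in Phi) F).
Proof.
move=> cPhi cU i; rewrite image_bigcup.
have := bigcup_image Phi (fun F => [set psi i @^-1` A | A in F]) id.
move=> /= <-; apply: gts_trans; first by move=> _ [F /cPhi ? <-].
have := cU i; rewrite !image_comp.
by congr gcov; apply: eq_imagel => F _ /=; rewrite pre_bigcup.
Qed.

Lemma glue_saturated F G :
  glue_cov F -> G `<=` glue_op -> finer F G -> glue_cov G.
Proof.
move=> cF oG [FG1 FG2] i; apply: gts_saturated (cF i) _ _.
  by move=> _ [W GW <-]; exact: oG.
split; first by rewrite -!pre_bigcup FG1.
move=> _ [A FA <-]; have [B GB AB] := FG2 _ FA.
by exists (psi i @^-1` B); [exists B|exact: preimage_subset].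
Qed.

Lemma glue_regular W F : glue_cov F -> famI W F `<=` glue_op ->
  glue_op (W `&` \bigcup_(A in F) A).
Proof.
move=> cF oWF i; rewrite preimage_setI pre_bigcup; apply: gts_regular => //.
by rewrite -pre_famI => _ [A WFA <-]; exact: oWF.
Qed.

Definition glue_gts : gts := Gts glue_cov_op glue_finite glue_stable
  glue_trans glue_saturated glue_regular.

Definition glue_sec (W : set glue_gts) : set (W -> M) :=
  [set f | forall i,
    space_sheaf (Y i) (psi i @^-1` W) (pullback (f := psi i) f)].

Lemma glue_sec_restr (U V : set glue_gts) (VU : V `<=` U) : gop U -> gop V ->
  forall f, @glue_sec U f -> @glue_sec V (restr VU f).
Proof.
move=> oU oV f Uf i.
have inc : psi i @^-1` V `<=` psi i @^-1` U by apply: preimage_subset.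
apply: sec_congr (@sec_restr _ _ (space_sheaf (Y i)) _ _ inc (oU i) (oV i)
  _ (Uf i)) => // x y xy.
by congr f; apply: val_inj => /=; rewrite xy.
Qed.

Lemma glue_sec_glue (F : set (set glue_gts)) (f : \bigcup_(A in F) A -> M) :
  gcov F ->
  (forall (A : set glue_gts) (AF : A `<=` \bigcup_(A in F) A),
    F A -> glue_sec (restr AF f)) -> glue_sec f.
Proof.
move=> cF Ff i.
apply: (@sec_cover _ _ _ [set psi i @^-1` A | A in F]).
- exact: cF.
- exact: pre_bigcup.
move=> _ /[swap] -[A FA <-] AU.
have AF : A `<=` \bigcup_(A in F) A by move=> x Ax; exists A.
apply: sec_congr (Ff A AF FA i) => // x y xy.
by congr f; apply: val_inj => /=; rewrite xy.
Qed.

Definition glue_sheaf : function_sheaf M glue_gts :=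
  FunctionSheaf glue_sec_restr (glue_functions glue_sec_glue).

Definition glue_space : space M := Space glue_sheaf.

Lemma glue_map_strict i : strictly_continuous (psi i : Y i -> glue_space).
Proof. by move=> F; exact. Qed.

Lemma glue_map_sec i (V : set glue_space) (h : V -> M) :
  gop V -> space_sheaf glue_space V h ->
  space_sheaf (Y i) (psi i @^-1` V) (pullback (f := psi i) h).
Proof. by move=> _; exact. Qed.

Definition glue_map i : morphism (Y i) glue_space :=
  Morphism (@glue_map_strict i) (@glue_map_sec i).

Hypothesis psi_inj : forall i, injective (psi i).
Hypothesis psi_surj : forall t, exists i, range (psi i) t.
(** A morphism b in one direction is enough, as i and k may be exchanged. *)
Hypothesis psi_overlap : forall i k,
  exists (O : space M) (a : morphism O (Y i)) (b : morphism O (Y k)),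
    [/\ open_embedding a, range a = psi i @^-1` range (psi k) &
        forall x, psi i (a x) = psi k (b x)].

Let overlap_preimage i k (O : space M) (a : morphism O (Y i))
    (b : morphism O (Y k)) (A : set (Y k)) :
  range a = psi i @^-1` range (psi k) ->
  (forall x, psi i (a x) = psi k (b x)) ->
  psi i @^-1` (psi k @` A) = a @` (b @^-1` A).
Proof.
move=> aE abE; apply/seteqP; split=> y.
  move=> /= [z Az zy]; have : range a y by rewrite aE; exists z.
  move=> [x _ xy]; exists x => //=; rewrite (_ : b x = z) //.
  by apply: (psi_inj (i := k)); rewrite -abE xy zy.
by move=> [x Ax <-] /=; rewrite abE; exists (b x).
Qed.

(** Seen in any Y i, the image of a set under psi k is the image under the open
embedding a of the overlap of the preimage of this set under b, and the same
holds for families and sections. *)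
Lemma glue_map_oemb k : open_embedding (glue_map k).
Proof.
split; first exact: psi_inj.
  move=> F cF i; have [O [a [b [ao aE abE]]]] := psi_overlap i k.
  have := oemb_cov ao (mfun_strict b cF); rewrite !image_comp; congr gcov.
  by apply: eq_imagel => A _ /=; rewrite (overlap_preimage A aE abE).
move=> W h oW hW i; have [O [a [b [ao aE abE]]]] := psi_overlap i k.
have pre := overlap_preimage W aE abE.
have inc : a @` (b @^-1` W) `<=` psi i @^-1` (psi k @` W) by rewrite pre.
have obW := preimage_gop (@mfun_strict _ _ _ b) oW.
have : space_sheaf (Y i) _ (restr inc (pullback (f := psi i) h)).
  apply: (oemb_sec ao) => //.
  have := @mfun_sec _ _ _ b _ _ oW hW; congr (space_sheaf _ _ _).
  by apply/funext => x; congr h; apply: val_inj => /=; rewrite abE.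
apply: sec_congr; first by rewrite pre.
by move=> x y xy; congr h; apply: val_inj => /=; rewrite xy.
Qed.

(** Seen in Y k, the family of images consists of open sets and contains Y k
itself. *)
Lemma glue_map_cover : gcov (range (fun i => range (glue_map i))).
Proof.
move=> k; apply: gcov_setT.
  move=> _ [_ [i _ <-] <-]; apply: (preimage_gop (@glue_map_strict k)).
  exact: oemb_range (glue_map_oemb i).
by exists (range (psi k)); [exists k|apply/seteqP; split=> // y _; exists y].
Qed.

End Gluing.

(** * Definable sets over finite sets of variables *)

Section FiniteContexts.
Context {L : signature} (M : wt_structure L).

Lemma definable_eq n (i j : 'I_n) :
  definable [set x : {ptws 'I_n -> M} | x i = x j].
Proof. by exists (Eq (Var M i) (Var M j)). Qed.

Lemma definable_ex n (A : set {ptws 'I_n.+1 -> M}) : definable A ->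
  definable [set x : {ptws 'I_n -> M} | exists y, A (snoc x y)].
Proof. by move=> [p ->]; exists (Ex p). Qed.

(** [snoc] appends a variable at the end, so the first n of m + n variables
survive m quantifications. *)
Let widen_index m n (i : 'I_n) : 'I_(m + n) := cast_ord (addnC n m) (lshift m i).

(** One existential quantifier for each of the m last variables. *)
Lemma definable_proj m n (A : set {ptws 'I_(m + n) -> M}) : definable A ->
  definable [set x : {ptws 'I_n -> M} |
    exists2 z, A z & z \o @widen_index m n = x].
Proof.
elim: m A => [|m IH] A dA.
  suff -> : [set x | exists2 z, A z & z \o @widen_index 0 n = x] = A by [].
  have wid (z : 'I_n -> M) : z \o @widen_index 0 n = z.
    by apply/funext => i; congr z; exact: val_inj.
  apply/seteqP; split=> x /=; last by exists x.
  by move=> [z Az <-]; rewrite wid.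
have := IH _ (definable_ex dA); congr definable; apply/seteqP; split=> x /=.
  move=> [z [y Azy] <-]; exists (snoc z y) => //.
  rewrite -[in RHS](snoc_lift z y); apply/funext => i /=.
  by congr snoc; apply: val_inj; rewrite /= /bump leqNgt ltn_addl.
move=> [z Az <-]; exists (z \o lift ord_max); last first.
  apply/funext => i /=; congr z.
  by apply: val_inj; rewrite /= /bump leqNgt ltn_addl.
exists (z ord_max); congr A: Az; apply/funext => i; rewrite /snoc.
by case: unliftP => [j|] ->.
Qed.

(** Graphs, fibres and products live in powers of M whose exponents are sums of
index types. Allowing any finite type as exponent replaces all the arithmetic
of positions by maps between index types. *)
Definition fdefinable (X : finType) (A : set (X -> M)) : Prop :=
  definable [set z : {ptws 'I_#|X| -> M} | A (z \o enum_rank)].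

Lemma fdefinable_preim (X Y : finType) (r : X -> Y) (A : set (X -> M)) :
  fdefinable A -> fdefinable [set y : Y -> M | A (y \o r)].
Proof.
move=> /(definable_preim (fun i => enum_rank (r (enum_val i)))).
congr definable; apply/seteqP; split=> z /=; congr A.
  by apply/funext => x; rewrite /= enum_rankK.
by apply/funext => x; rewrite /= enum_rankK.
Qed.

Lemma fdefinableE n (A : set {ptws 'I_n -> M}) :
  @fdefinable 'I_n A <-> definable A.
Proof.
split; last exact: definable_preim.
move=> /(definable_preim enum_val); congr definable.
apply/seteqP; split=> x /=; congr A.
  by apply/funext => i /=; rewrite enum_rankK.
by apply/funext => i /=; rewrite enum_rankK.
Qed.

Lemma fdefinable_pull (X : finType) n (r : 'I_n -> X)
    (A : set {ptws 'I_n -> M}) :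
  definable A -> fdefinable [set x : X -> M | A (x \o r)].
Proof. by move=> /fdefinableE; exact: fdefinable_preim. Qed.

Lemma fdefinableI (X : finType) (A B : set (X -> M)) :
  fdefinable A -> fdefinable B -> fdefinable (A `&` B).
Proof. exact: definableI. Qed.

Lemma fdefinable_forall (X K : finType) (A : K -> set (X -> M)) :
  (forall k, fdefinable (A k)) -> fdefinable [set x | forall k, A k x].
Proof.
move=> dA; suff : fdefinable [set x | forall k, k \in enum K -> A k x].
  by congr fdefinable; apply/seteqP; split=> x /= h k => [|_];
    apply: h; rewrite mem_enum.
elim: (enum K) => [|k s IH].
  by have := definableT M #|X|; congr definable; apply/seteqP; split.
have := fdefinableI (dA k) IH; congr fdefinable; apply/seteqP; split=> x /=.
  by move=> [Ax sx] l; rewrite inE => /orP[/eqP ->|/sx].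
move=> h; split=> [|l ls]; apply: h; rewrite inE ?eqxx // ls; exact: orbT.
Qed.

Lemma fdefinable_eq (X : finType) (i j : X) :
  fdefinable [set x : X -> M | x i = x j].
Proof. exact: definable_eq. Qed.

(** The image of A under the restriction of points along r is a projection of
the set of pairs (y, x) with y in A and x = y \o r. The formula has all
variables from Y and all those from X, the latter first as they are to be
kept. *)
Lemma fdefinable_image (X Y : finType) (r : X -> Y) (A : set (Y -> M)) :
  fdefinable A -> fdefinable [set x | exists2 y, A y & y \o r = x].
Proof.
move=> dA.
pose iX (i : 'I_#|X|) : 'I_(#|Y| + #|X|) := widen_index _ i.
pose iY (y : Y) : 'I_(#|Y| + #|X|) :=
  cast_ord (addnC _ _) (rshift #|X| (enum_rank y)).
have dB : definable [set w : {ptws 'I_(#|Y| + #|X|) -> M} | A (w \o iY)].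
  by apply/fdefinableE; exact: fdefinable_preim.
have dE : definable [set w : {ptws 'I_(#|Y| + #|X|) -> M} |
    forall i, w (iX i) = w (iY (r (enum_val i)))].
  apply/fdefinableE.
  by apply: fdefinable_forall => i; apply/fdefinableE; exact: definable_eq.
have := definable_proj (definableI dB dE); congr definable.
apply/seteqP; split=> x /=.
  move=> [w [Aw wE] <-]; exists (w \o iY) => //.
  by apply/funext => i; rewrite /= -[in LHS](enum_rankK i) -wE.
move=> [y Ay yx].
(* The point of the big context determined by y. *)
pose w (c : 'I_(#|Y| + #|X|)) := match fintype.split (cast_ord (addnC _ _) c) with
  inl i => y (r (enum_val i)) | inr j => y (enum_val j) end.
have wY : w \o iY = y.
  apply/funext => j; rewrite /w /iY /= cast_ord_comp cast_ord_id.
  by rewrite (unsplitK (inr _)) enum_rankK.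
have wX i : w (iX i) = y (r (enum_val i)).
  rewrite /w /iX /widen_index cast_ord_comp cast_ord_id.
  by rewrite (unsplitK (inl _)).
exists w; first split; first by rewrite wY.
  by move=> i; rewrite wX -wY.
apply/funext => i; rewrite /= -/(iX i) wX.
by have := congr1 (@^~ (enum_val i)) yx => /= ->; rewrite enum_valK.
Qed.

End FiniteContexts.

(** * Morphisms between definable sets *)

Lemma comp_snoc (T S : Type) (h : T -> S) n (x : 'I_n -> T) (y : T) :
  h \o snoc x y = snoc (h \o x) (h y).
Proof. by apply/funext => i; rewrite /= /snoc; case: unlift. Qed.

Lemma snoc_inj (T : Type) n (x x' : 'I_n -> T) y y' :
  snoc x y = snoc x' y' -> x = x' /\ y = y'.
Proof.
move=> h; split; first by rewrite -(snoc_lift x y) h snoc_lift.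
by rewrite -(snoc_max x y) h snoc_max.
Qed.

Section DefinableMaps.
Context {L : signature} (M : wt_structure L).

Lemma graph_snoc n (D : set {ptws 'I_n -> M}) (U : set D) (f : U -> M) a b :
  graph f (snoc a b) <-> exists2 x : U, val (val x) = a & f x = b.
Proof.
split; first by move=> [x _ e]; have [? ?] := snoc_inj e; exists x.
by move=> [x <- <-]; exists x.
Qed.

(** A map g to a definable set E of M^m whose coordinates are sections: its
graph is the intersection of the conditions given by the graphs of its
coordinates, and continuity into a product is continuity of the coordinates. *)
Section Coordinates.
Context (n m : nat) (D : set {ptws 'I_n -> M}) (E : set {ptws 'I_m -> M}).
Context (dD : definable D) (dE : definable E).
Context (g : D -> E).

Definition coordinate (k : 'I_m) : [set: D] -> M :=
  fun x => val (g (val x)) k.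

Hypothesis gP : forall k, def_sec (@coordinate k).

Lemma map_graph_definable :
  @fdefinable _ M ('I_n + 'I_m)%type [set z : 'I_n + 'I_m -> M | exists2 x : D,
    val x = z \o inl & val (g x) = z \o inr].
Proof.
have h : @fdefinable _ M ('I_n + 'I_m)%type
    [set z : 'I_n + 'I_m -> M |
      forall k, graph (@coordinate k) (z \o snoc inl (inr k))].
  by apply: fdefinable_forall => k; apply: fdefinable_pull; case: (gP k).
have := fdefinableI (fdefinable_pull inl dD) h; congr fdefinable.
apply/seteqP; split=> z /=.
  move=> [Dz zg].
  pose x : D := exist _ (z \o inl : {ptws 'I_n -> M}) (mem_set Dz).
  exists x => //; apply/funext => k.
  have := zg k; rewrite comp_snoc graph_snoc => -[y yz yk].
  rewrite [RHS]/= -yk; congr (val (g _) k).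
  by apply: val_inj; rewrite yz.
move=> [x xz gz]; split; first by rewrite -xz; exact: set_valP.
move=> k; rewrite comp_snoc graph_snoc.
by exists (exist _ x (mem_set I)) => //; rewrite /coordinate /= gz.
Qed.

Lemma map_continuous : continuous (fun x : D => val (g x) : {ptws 'I_m -> M}).
Proof.
move=> x; apply/cvg_sup => [|k]; first exact/fmap_filter/(nbhs_filter x).
move: x.
apply: continuous_comp_initial; apply/continuousP => B oB.
have [/continuousP/(_ B oB) [A oA AE] _] := gP k.
suff -> : ((fun f : {ptws 'I_m -> M} => f k) \o (fun x : D => val (g x))) @^-1` B
    = A by [].
apply/seteqP; split=> x.
  move=> Bx; have := congr1 (@^~ (exist _ x (mem_set (I : [set: D] x)))) AE.
  by rewrite /preimage /mkset /= => ->.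
move=> Ax; have := congr1 (@^~ (exist _ x (mem_set (I : [set: D] x)))) AE.
by rewrite /preimage /mkset /= => <-.
Qed.

(** The preimage of W is the projection to D of the part of the graph over
W. *)
Lemma map_preimage_open (W : set E) : def_op W -> def_op (g @^-1` W).
Proof.
move=> [oW dW]; split.
  have gc : continuous g by exact: continuous_comp_initial map_continuous.
  by move/continuousP: gc; exact.
apply/fdefinableE.
have := fdefinableI map_graph_definable (fdefinable_pull inr dW).
move=> /(fdefinable_image inl); congr fdefinable; apply/seteqP; split=> x.
  move=> [z [[y yz gyz] [w Ww wz]] <-]; exists y => //=.
  by rewrite (_ : g y = w) //; apply: val_inj; rewrite gyz wz.
move=> [y Wy <-].
exists (fun i => match i with inl i => val y i | inr i => val (g y) i end) => //.
by split=> /=; [exists y|exists (g y)].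
Qed.

Lemma map_strict :
  strictly_continuous (g : definable_space dD -> definable_space dE).
Proof.
move=> F [oF [G [finG GF GE]]].
split; first by move=> _ [A FA <-]; exact/map_preimage_open/oF.
exists [set g @^-1` A | A in G]; split; first exact: finite_image.
  exact: image_subset.
by rewrite !bigcup_image -!preimage_bigcup GE.
Qed.

(** The graph of h \o g is obtained from those of g and h by quantifying over
the intermediate point of E. *)
Lemma map_sec (V : set E) (h : V -> M) :
  def_sec h -> def_sec (pullback (f := g) h).
Proof.
move=> [hc hd]; split.
  (* Corestricted to V, the map g is continuous, as V has the initial
     topology. *)
  have c : continuous (smap (f := g) (fun=> id) : g @^-1` V -> V).
    do 2 apply: continuous_comp_initial.
    have -> : set_val \o (set_val \o smap (f := g) (fun=> id)) =
        (fun x : D => val (g x) : {ptws 'I_m -> M}) \o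
        (set_val : g @^-1` V -> D) by [].
    move=> x; apply: continuous_comp; first exact: initial_continuous.
    exact: map_continuous.
  move=> x; apply: continuous_comp; [exact: c|exact: hc].
apply/fdefinableE.
pose X : finType := ('I_n.+1 + 'I_m)%type.
pose r (i : 'I_n + 'I_m) : X :=
  match i with inl i => inl (lift ord_max i) | inr j => inr j end.
have := fdefinableI (fdefinable_preim r map_graph_definable)
  (fdefinable_pull (X := X) (snoc inr (inl ord_max)) hd).
move=> /(fdefinable_image inl); congr fdefinable; apply/seteqP; split=> z.
  move=> [w [[y yw gw]]]; rewrite /= comp_snoc graph_snoc => -[v vw hv] <-.
  have gy : g y = val v by apply: val_inj; rewrite gw vw.
  have Vy : (g @^-1` V) y by rewrite /= gy; exact: set_valP.
  exists (exist _ y (mem_set Vy)) => //=.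
  have -> : w \o inl = snoc (val y) (h v).
    apply/funext => i; rewrite /snoc.
    by case: unliftP => [j|] -> /=; [rewrite yw|rewrite hv].
  by congr snoc; congr h; apply: val_inj.
move=> [y _ <-].
exists (fun i => match i with
    | inl i => snoc (val (val y)) (pullback (f := g) h y) i
    | inr i => val (g (val y)) i
  end) => //.
split=> /=.
  exists (val y) => //; apply/funext => i /=.
  by rewrite -[in LHS](snoc_lift (val (val y)) (pullback (f := g) h y)).
rewrite comp_snoc graph_snoc /= snoc_max.
by exists (smap (f := g) (fun=> id) y).
Qed.

Lemma map_morphism :
  exists f : morphism (definable_space dD) (definable_space dE), mfun f = g.
Proof.
have gs (V : set (definable_space dE)) (h : V -> M) : gop V ->
    space_sheaf (definable_space dE) V h ->
    space_sheaf (definable_space dD) (g @^-1` V) (pullback (f := g) h).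
  by move=> _; exact: map_sec.
by exists (Morphism map_strict gs).
Qed.

End Coordinates.

(** The graph of a coordinate is cut out of the preimage of D by an equation
between two variables. *)
Lemma coordinate_sec n (D : set {ptws 'I_n -> M}) (dD : definable D) (k : 'I_n) :
  def_sec (coordinate (D := D) id k).
Proof.
split.
  have -> : coordinate id k = (fun f : {ptws 'I_n -> M} => f k) \o
      ((set_val : D -> {ptws 'I_n -> M}) \o (set_val : [set: D] -> D)) by [].
  move=> x; apply: continuous_comp; last first.
    exact: (@proj_continuous _ (fun _ : 'I_n => M : topologicalType) k).
  by apply: continuous_comp; exact: initial_continuous.
apply/fdefinableE.
have := fdefinableI (fdefinable_pull (lift ord_max) dD)
  (fdefinable_eq M ord_max (lift ord_max k)).
congr fdefinable; apply/seteqP; split=> z /=.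
  move=> [Dz zk].
  pose x : D := exist _ (z \o lift ord_max : {ptws 'I_n -> M}) (mem_set Dz).
  exists (exist _ x (mem_set I)) => //.
  apply/funext => i; rewrite /snoc.
  by case: unliftP => [j|] -> //=; rewrite /coordinate /= zk.
move=> [x _ <-]; rewrite /= snoc_lift snoc_max; split; first exact: set_valP.
by rewrite -[in RHS](comp_snoc id) /= /snoc liftK.
Qed.

Section DefinableInclusion.
Context (n : nat) (A D : set {ptws 'I_n -> M}).
Context (dA : definable A) (dD : definable D) (AD : A `<=` D).

Definition def_incl (x : A) : D :=
  exist _ (val x) (mem_set (AD (set_valP x))).

Lemma def_incl_morphism :
  exists f : morphism (definable_space dA) (definable_space dD),
    mfun f = def_incl.
Proof. by apply: map_morphism => k; exact: coordinate_sec. Qed.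

Lemma def_incl_image (W : set A) :
  val @` (def_incl @` W) = val @` W :> set {ptws 'I_n -> M}.
Proof. by rewrite image_comp. Qed.

(** A relatively open subset of A is the intersection of A and an open set of
M^n, hence open in D as A is; definable subsets of A, and graphs of functions
on them, are the same subsets of powers of M whether A or D is taken as the
surrounding space. *)
Lemma def_incl_oemb : def_op (range def_incl) ->
  open_embedding (def_incl : definable_space dA -> definable_space dD).
Proof.
move=> [oA _].
have inj : injective def_incl by move=> x y [/val_inj].
have oW (W : set A) : def_op W -> def_op (def_incl @` W).
  move=> [[O oO OW] dW]; split; last by rewrite def_incl_image.
  suff -> : def_incl @` W = range def_incl `&` set_val @^-1` O.
    by apply: openI => //; exists O.
  rewrite -OW; apply/seteqP; split=> x.
    by move=> [y Oy <-]; split => //; exists y.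
  by move=> [[y _ <-] Oy]; exists y.
split=> //.
  move=> F [oF [G [finG GF GE]]].
  split; first by move=> _ [W FW <-]; exact/oW/oF.
  exists [set def_incl @` W | W in G]; split; first exact: finite_image.
    exact: image_subset.
  by rewrite !bigcup_image -!image_bigcup GE.
move=> W h _ [hc hd]; split.
  apply/continuousP => B oB; move/continuousP/(_ B oB): hc => [_ [O oO <-] OB].
  exists (set_val @^-1` O); first by exists O.
  apply/seteqP; split=> y; have [x Wx xy] := set_valP y.
    have yE : smap (@preimage_image _ _ def_incl W) (exist _ x (mem_set Wx)) = y.
      exact: val_inj.
    move=> Oy; have := congr1 (@^~ (exist _ x (mem_set Wx))) OB.
    rewrite /preimage /mkset /= yE => <-.
    by have : O (val (val y)) by []; rewrite -xy.
  have yE : smap (@preimage_image _ _ def_incl W) (exist _ x (mem_set Wx)) = y.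
    exact: val_inj.
  move=> By; have := congr1 (@^~ (exist _ x (mem_set Wx))) OB.
  rewrite /preimage /mkset /= yE => OBx.
  have : B (h y) by [].
  rewrite -OBx => Ox; suff : O (val (val y)) by [].
  by rewrite -xy.
move: hd; congr definable; apply/seteqP; split=> z.
  by move=> [x _ <-]; exists (smap (@preimage_image _ _ def_incl W) x).
move=> [y _ <-]; have [x Wx xy] := set_valP y.
exists (exist _ x (mem_set Wx)) => //=.
rewrite -xy; congr (snoc _ (h _)); exact: val_inj.
Qed.

End DefinableInclusion.

End DefinableMaps.

(** * Charts and atlases *)

Section Charts.
Context {L : signature} (M : wt_structure L).
Implicit Types X Z : space M.

(** A chart is given by its parametrization, from the definable set to the
space, so that gluing and restriction only compose morphisms. *)
Record chart (X : space M) := Chart {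
  cdim : nat;
  cdom : set {ptws 'I_cdim -> M};
  cdef : definable cdom;
  cmap : morphism (definable_space cdef) X;
  cmap_oemb : open_embedding cmap }.

Arguments cdom {X} c.
Arguments cdef {X} c.

Definition atlas X (C : set (chart X)) : Prop :=
  gcov [set range (cmap c) | c in C] /\
  forall x, exists2 c, C c & range (cmap c) x.

(** Admissibility of an atlas only depends on the family of its ranges. *)
Lemma atlas_of_cover X (U : set (set X)) : gcov U ->
  \bigcup_(A in U) A = setT ->
  (forall A, U A -> exists c : chart X, range (cmap c) = A) ->
  atlas [set c : chart X | U (range (cmap c))].
Proof.
move=> cU UT Uc; split.
  suff -> : [set range (cmap c) | c in [set c : chart X | U (range (cmap c))]] = U.
    by [].
  apply/seteqP; split=> [_ [c Uc' <-] //|A UA].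
  by have [c cA] := Uc A UA; rewrite -cA in UA *; exists c.
move=> x; have : (\bigcup_(A in U) A) x by rewrite UT.
move=> [A UA Ax]; have [c cA] := Uc A UA; rewrite -cA in UA Ax.
by exists c.
Qed.

Lemma locally_definableP X :
  locally_definable X <-> exists C : set (chart X), atlas C.
Proof.
split.
  move=> [U [cU UT Uaff]]; eexists; apply: (atlas_of_cover cU UT) => A UA.
  have oA := gcov_gop cU UA.
  have [n [D [dD [f [g [gf fg]]]]]] := Uaff A oA UA.
  pose f' : morphism (open_subspace oA) (definable_space dD) := f.
  pose g' : morphism (definable_space dD) (open_subspace oA) := g.
  have gfK y : g' (f' y) = y := congr1 (fun h : morphism _ _ => h y) gf.
  have fgK y : f' (g' y) = y := congr1 (fun h : morphism _ _ => h y) fg.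
  have go : open_embedding g' := oemb_iso fgK gfK.
  exists (Chart (oemb_comp (inclusion_oemb oA) go)) => /=.
  rewrite -[RHS](inclusion_range oA); apply/seteqP; split=> x.
    by move=> [y _ <-]; exists (g' y).
  by move=> [y _ <-]; exists (f' y) => //=; rewrite gfK.
move=> [C [cC CT]]; exists [set range (cmap c) | c in C]; split=> //.
  apply/seteqP; split=> // x _; have [c Cc cx] := CT x.
  by exists (range (cmap c)) => //; exists c.
move=> A oA [c Cc cA]; exists (cdim c), (cdom c), (cdef c).
exact: oemb_isomorphic (cmap_oemb c) cA.
Qed.

Lemma atlas_local X Z (C : set (chart X)) (f : X -> Z) : atlas C ->
  (forall c, C c -> exists g : morphism (definable_space (cdef c)) Z,
    forall y, f (cmap c y) = g y) ->
  exists f' : morphism X Z, mfun f' = f.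
Proof.
move=> [cC CT] fC; pose I := {c | C c}.
pose g (i : I) := sval (cid (fC (sval i) (svalP i))).
apply: (@morphism_local _ _ _ I _ (fun i => cmap (sval i)) f g).
- by move=> i; exact: cmap_oemb.
- move: cC; congr gcov; apply/seteqP; split=> _ [c Cc <-].
    by exists (exist _ c Cc).
  by exists (sval c) => //; exact: svalP.
- by move=> x; have [c Cc cx] := CT x; exists (exist _ c Cc).
- by move=> i; exact: (svalP (cid (fC (sval i) (svalP i)))).
Qed.

(** An open definable subset of a definable set is the range of a chart, namely
of the subset considered as a definable set of its own. *)
Lemma open_chart n (D : set {ptws 'I_n -> M}) (dD : definable D) (O : set D) :
  def_op O -> exists c : chart (definable_space dD), range (cmap c) = O.
Proof.
move=> oO; have [_ dO] := oO.
have OD : val @` O `<=` D by move=> _ [x _ <-]; exact: set_valP.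
have rO : range (def_incl OD) = O.
  apply/seteqP; split=> x.
    move=> [[y Oy] _ <-]; have /set_mem [z Oz zy] := Oy.
    by rewrite (_ : def_incl _ _ = z) //; apply: val_inj; rewrite /= zy.
  move=> Ox; have Ovx : (val @` O) (val x) by exists x.
  by exists (exist _ (val x) (mem_set Ovx)) => //; exact: val_inj.
have [i iE] := def_incl_morphism dO dD OD.
have io : open_embedding i.
  by rewrite iE; apply: def_incl_oemb; rewrite rO.
by exists (Chart io); rewrite /= iE.
Qed.

(** * The structure induced on a set by finitely many maps *)

(** The maps p k separate the points of T and the X k have atlases. If each
choice of charts cuts out a definable set of coordinates in the product
([dom_def] below), T becomes a locally definable space such that, for f from a
locally definable space to T, f is a morphism as soon as all p k \o f are.
Everything is indexed by a finite ordinal, and not by the objects of a diagram,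
because the carrier of a space must live in a smaller universe than the objects
of a category. *)
Section InitialStructure.
Context (N : nat) (X : 'I_N -> space M) (C : forall k, set (chart (X k))).
Context (T : Type) (p : forall k, T -> X k).
Arguments p : clear implicits.
Arguments C : clear implicits.
Hypothesis atlasC : forall k, atlas (C k).
Hypothesis p_inj : forall t t', (forall k, p k t = p k t') -> t = t'.

Section JointChart.
Context (c : forall k, chart (X k)).

Definition joint_var : finType := {k : 'I_N & 'I_(cdim (c k))}.

Definition joint_block k (z : {ptws 'I_#|joint_var| -> M}) :
    {ptws 'I_(cdim (c k)) -> M} :=
  fun i => z (enum_rank (Tagged (fun k => 'I_(cdim (c k))) i : joint_var)).

Arguments joint_block k z : clear implicits.

(** Read in the charts c, the part of T on which each p k takes its values in
the chart c k. *)
Definition joint_dom : set {ptws 'I_#|joint_var| -> M} :=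
  [set z | exists t, forall k,
    exists2 x : cdom (c k), val x = joint_block k z & cmap (c k) x = p k t].

Definition joint_map (z : joint_dom) : T := sval (cid (set_valP z)).

Lemma joint_mapP (z : joint_dom) k :
  exists2 x : cdom (c k),
    val x = joint_block k (val z) & cmap (c k) x = p k (joint_map z).
Proof. exact: (svalP (cid (set_valP z))). Qed.

Lemma joint_coord_subproof k (z : joint_dom) : cdom (c k) (joint_block k (val z)).
Proof. by have [x <- _] := joint_mapP z k; exact: set_valP. Qed.

Definition joint_coord k (z : joint_dom) : cdom (c k) :=
  exist _ (joint_block k (val z)) (mem_set (joint_coord_subproof k z)).

Lemma cmap_joint_coord k (z : joint_dom) :
  cmap (c k) (joint_coord k z) = p k (joint_map z).
Proof.
have [x xz <-] := joint_mapP z k; congr (mfun _ _).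
by apply: val_inj; rewrite /= xz.
Qed.

Lemma joint_map_inj : injective joint_map.
Proof.
move=> z z' zz'; apply: val_inj; apply/funext => i.
have h k : joint_coord k z = joint_coord k z'.
  by apply: (oemb_inj (cmap_oemb (c k))); rewrite !cmap_joint_coord zz'.
rewrite -(enum_valK i); case: (enum_val i) => k j.
exact: (congr1 (fun x => val x j) (h k)).
Qed.

Lemma joint_map_range t : range joint_map t <-> forall k, range (cmap (c k)) (p k t).
Proof.
split.
  by move=> [z _ <-] k; exists (joint_coord k z); rewrite ?cmap_joint_coord.
move=> tc; have ex k : exists x, cmap (c k) x = p k t.
  by have [x _ <-] := tc k; exists x.
(* The coordinates of t in the charts, put end to end. *)
pose x k := sval (cid (ex k)).
pose w (s : joint_var) : M := val (x (tag s)) (tagged s).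
pose z : {ptws 'I_#|joint_var| -> M} := w \o enum_val.
have zt k : exists2 y : cdom (c k), val y = joint_block k z & cmap (c k) y = p k t.
  exists (x k); last exact: (svalP (cid (ex k))).
  by apply/funext => i; rewrite /joint_block /z /= enum_rankK.
have dz : joint_dom z by exists t.
pose u : joint_dom := exist _ z (mem_set dz).
exists u => //; apply: p_inj => k; have [y yz <-] := joint_mapP u k.
have [y' yz' <-] := zt k; congr (mfun _ _); apply: val_inj.
by rewrite yz yz'.
Qed.

Context (dom_def : definable joint_dom).

Lemma joint_coord_morphism k :
  exists g : morphism (definable_space dom_def) (definable_space (cdef (c k))),
    mfun g = joint_coord k.
Proof. by apply: map_morphism => i; exact: coordinate_sec. Qed.

Lemma joint_map_leg k : exists g : morphism (definable_space dom_def) (X k),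
  forall z, g z = p k (joint_map z).
Proof.
have [g gE] := joint_coord_morphism k.
by exists (comp_morphism (cmap (c k)) g) => z /=; rewrite gE cmap_joint_coord.
Qed.

(** Each p k \o f factors through the chart c k; the factors are the blocks of
coordinates of the map to the joint domain, so its coordinates are sections. *)
Lemma joint_lift n (E : set {ptws 'I_n -> M}) (dE : definable E) (f : E -> T)
    (fk : forall k, morphism (definable_space dE) (X k)) :
  (forall k z, p k (f z) = fk k z) ->
  (forall k z, range (cmap (c k)) (fk k z)) ->
  exists g : morphism (definable_space dE) (definable_space dom_def),
    forall z, joint_map (g z) = f z.
Proof.
move=> fkE fkc.
pose h k := sval (cid (oemb_factor (cmap_oemb (c k)) (fkc k))).
have hE k z : cmap (c k) (h k z) = fk k z.
  exact: (svalP (cid (oemb_factor (cmap_oemb (c k)) (fkc k)))).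
have /choice [g gE] : forall z, exists w, joint_map w = f z.
  move=> z.
  have /joint_map_range [w _ wf] : forall k, range (cmap (c k)) (p k (f z)).
    by move=> k; rewrite fkE.
  by exists w.
suff [g' g'E] :
    exists g' : morphism (definable_space dE) (definable_space dom_def),
      mfun g' = g by exists g' => z; rewrite g'E.
have gh k z : joint_coord k (g z) = h k z.
  by apply: (oemb_inj (cmap_oemb (c k))); rewrite cmap_joint_coord gE fkE hE.
apply: map_morphism => i; rewrite -(enum_valK i).
case: (enum_val i) => k j.
have := @mfun_sec _ _ _ (h k) _ _ (gopT _) (coordinate_sec (cdef (c k)) j).
apply: (sec_congr (G := def_sheaf dE)) => //.
move=> x y xy; rewrite /coordinate /pullback /= xy.
by rewrite -gh.
Qed.

End JointChart.

Arguments joint_dom c : clear implicits.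
Arguments joint_map c z : clear implicits.

Hypothesis dom_def : forall c, (forall k, C k (c k)) -> definable (joint_dom c).

Definition joint_index := {c : forall k, chart (X k) | forall k, C k (c k)}.

Definition joint_space (i : joint_index) := definable_space (dom_def (svalP i)).

Definition initial_map (i : joint_index) : joint_space i -> T := @joint_map (sval i).

Definition initial_space : space M := glue_space initial_map.

(** A point of T lies in the charts d if its finitely many images under the p k
do; each of these conditions is open in the joint domain of c. *)
Lemma joint_map_preimage_open (c d : forall k, chart (X k))
    (dc : definable (joint_dom c)) :
  def_op (joint_map c @^-1` range (joint_map d)).
Proof.
have ex k := joint_map_leg dc k; pose g k := sval (cid (ex k)).
have gE k z : g k z = p k (joint_map c z) by exact: (svalP (cid (ex k))).
have : gop (\bigcap_(A in range (fun k => g k @^-1` range (cmap (d k)))) A).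
  have [||_ + _] := @gts_finite (definable_space dc)
    (range (fun k => g k @^-1` range (cmap (d k)))).
  - by apply: finite_image; exact: finite_finset.
  - move=> _ [k _ <-]; apply: (preimage_gop (@mfun_strict _ _ _ (g k))).
    exact: oemb_range (cmap_oemb (d k)).
  - exact.
congr def_op; apply/seteqP; split=> z.
  move=> zg; apply/joint_map_range => k; rewrite -gE.
  by apply: (zg (g k @^-1` range (cmap (d k)))); exists k.
move=> /joint_map_range zd _ [k _ <-].
by suff : range (cmap (d k)) (g k z) by []; rewrite gE; exact: zd.
Qed.

Lemma initial_map_inj i : injective (@initial_map i).
Proof. exact: joint_map_inj. Qed.

Lemma initial_map_surj t : exists i, range (@initial_map i) t.
Proof.
have ex k : exists2 c, C k c & range (cmap c) (p k t) by case: (atlasC k) => _.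
pose c k := s2val (cid2 (ex k)).
have Cc k : C k (c k) by exact: (s2valP (cid2 (ex k))).
exists (exist _ c Cc); apply/joint_map_range => k.
exact: (s2valP' (cid2 (ex k))).
Qed.

(** The part of one joint domain that meets another is open, hence a definable
set of its own, and it maps to the other one by [joint_lift]. *)
Lemma initial_map_overlap i k :
  exists (O : space M) (a : morphism O (joint_space i))
      (b : morphism O (joint_space k)),
    [/\ open_embedding a, range a = @initial_map i @^-1` range (@initial_map k) &
        forall x, initial_map (a x) = initial_map (b x)].
Proof.
have [a aE] := open_chart (dom_def (svalP i))
  (joint_map_preimage_open (sval k) (dom_def (svalP i))).
have ex l := joint_map_leg (dom_def (svalP i)) l; pose g l := sval (cid (ex l)).
have gE l z : g l z = p l (joint_map _ z) by exact: (svalP (cid (ex l))).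
have [||b bE] := @joint_lift (sval k) (dom_def (svalP k)) _ _ (cdef a)
  (fun z => joint_map _ (cmap a z)) (fun l => comp_morphism (g l) (cmap a)).
- by move=> l z /=; rewrite gE.
- move=> l z /=; rewrite gE; move: l; apply/joint_map_range.
  have : range (cmap a) (cmap a z) by exists z.
  by rewrite aE.
exists _, (cmap a), b; split=> // [|x]; first exact: cmap_oemb.
by rewrite /initial_map bE.
Qed.

Let imap i : morphism (joint_space i) initial_space := glue_map initial_map i.

Let imap_oemb i : open_embedding (imap i).
Proof.
exact: (glue_map_oemb initial_map_inj initial_map_overlap).
Qed.

Lemma initial_atlas :
  atlas (range (fun i => Chart (imap_oemb i)) : set (chart initial_space)).
Proof.
split.
  have := glue_map_cover initial_map_inj initial_map_overlap.
  by rewrite image_comp.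
move=> t; have [i ti] := initial_map_surj t.
by exists (Chart (imap_oemb i)) => //; exists i.
Qed.

Lemma initial_leg k : exists g : morphism initial_space (X k), mfun g = p k.
Proof.
apply: (atlas_local initial_atlas) => _ [i _ <-].
have [g gE] := joint_map_leg (dom_def (svalP i)) k.
by exists g => y; rewrite gE.
Qed.

(** If the first m of the maps fk k each stay in one chart, f is a morphism. By
induction on the number r of remaining indices: pulling back the atlas of the
next X k covers E by open definable sets, on each of which one more map stays
in a chart; for r = 0, [joint_lift] applies. *)
Lemma initial_affine r m : (r + m)%N = N ->
  forall n (E : set {ptws 'I_n -> M}) (dE : definable E) (f : E -> T)
    (fk : forall k, morphism (definable_space dE) (X k)),
  (forall k z, p k (f z) = fk k z) ->
  (forall k : 'I_N, (k < m)%N ->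
    exists2 c, C k c & forall z, range (cmap c) (fk k z)) ->
  exists g : morphism (definable_space dE) initial_space, mfun g = f.
Proof.
elim: r m => [|r IH] m rm n E dE f fk fkE fkc.
  have ex k : exists2 c, C k c & forall z, range (cmap c) (fk k z).
    by apply: fkc; rewrite -[m]add0n rm.
  pose c k := s2val (cid2 (ex k)).
  have Cc k : C k (c k) by exact: (s2valP (cid2 (ex k))).
  have cE k z : range (cmap (c k)) (fk k z) by exact: (s2valP' (cid2 (ex k))).
  pose i : joint_index := exist _ c Cc.
  have [g gE] := joint_lift (dom_def (svalP i)) fkE cE.
  by exists (comp_morphism (imap i) g); apply/funext => z; exact: gE.
(* The atlas of X k0 is pulled back to E along fk k0. *)
have mN : (m < N)%N by rewrite -rm addSn ltnS leq_addl.
pose k0 := Ordinal mN; have [c0 C0] := atlasC k0.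
have c0' := mfun_strict (fk k0) c0.
have {}c0' := atlas_of_cover c0'.
apply: (atlas_local (c0' _ _)) => [||a].
- apply/seteqP; split=> // z _; have [c Cc cz] := C0 (fk k0 z).
  exists (fk k0 @^-1` range (cmap c)) => //.
  by exists (range (cmap c)) => //; exists c.
- move=> A UA; apply: open_chart.
  exact: gcov_gop (mfun_strict (fk k0) c0) A UA.
move=> [_ [c Cc <-] ca].
have [|||g gE] := IH m.+1 _ _ _ (cdef a) (fun z => f (cmap a z))
   (fun k => comp_morphism (fk k) (cmap a)).
- by rewrite addnS -addSn.
- by move=> k z; exact: fkE.
- move=> k; rewrite ltnS leq_eqVlt => /orP[/eqP km|km].
    have -> : k = k0 by exact: val_inj.
    exists c => // z.
    suff : (fk k0 @^-1` range (cmap c)) (cmap a z) by [].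
    by rewrite ca; exists z.
  have [c' Cc' c'E] := fkc k km; exists c' => // z.
  exact: c'E.
by exists g => y; rewrite gE.
Qed.

(** Testing on an atlas of Z reduces to the affine case, with no index
settled. *)
Lemma initial_lift Z (f : Z -> T) : locally_definable Z ->
  (forall k, exists g : morphism Z (X k), forall z, p k (f z) = g z) ->
  exists g : morphism Z initial_space, mfun g = f.
Proof.
move=> /locally_definableP [A atlasA] ex; pose fk k := sval (cid (ex k)).
have fkE k z : p k (f z) = fk k z by exact: (svalP (cid (ex k))).
apply: (atlas_local atlasA) => a _.
have [|||g gE] := @initial_affine N 0 _ _ _ (cdef a) (fun z => f (cmap a z))
   (fun k => comp_morphism (fk k) (cmap a)).
- exact: addn0.
- by move=> k z; exact: fkE.
- by [].
by exists g => y; rewrite gE.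
Qed.

End InitialStructure.

End Charts.

Arguments cdom {L M X} c.
Arguments cdef {L M X} c.
Arguments joint_block {L M N X c} k z.
Arguments joint_dom {L M N X T} p c.

(** * Limits of finite diagrams *)

Section Transition.
Context {L : signature} (M : wt_structure L).

(** The coordinates of a morphism are sections, being pulled back from the
coordinate functions of its target. *)
Lemma morphism_graph_definable n m (D : set {ptws 'I_n -> M})
    (E : set {ptws 'I_m -> M}) (dD : definable D) (dE : definable E)
    (g : morphism (definable_space dD) (definable_space dE)) :
  @fdefinable _ M ('I_n + 'I_m)%type [set z : 'I_n + 'I_m -> M |
    exists2 x : D, val x = z \o inl & val (g x : E) = z \o inr].
Proof.
apply: (map_graph_definable dD) => k.
have := @mfun_sec _ _ _ g _ _ (gopT _) (coordinate_sec dE k).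
by apply: (sec_congr (G := def_sheaf dD)) => // x y xy; rewrite /coordinate -xy.
Qed.

(** The graph of phi read in the charts c and d. *)
Definition transition (X Z : space M) (c : chart X) (d : chart Z)
    (phi : morphism X Z) : set ('I_(cdim c) + 'I_(cdim d) -> M) :=
  [set z : 'I_(cdim c) + 'I_(cdim d) -> M | exists (x : cdom c) (y : cdom d),
    [/\ val x = z \o inl, val y = z \o inr & phi (cmap c x) = cmap d y]].

Arguments transition {X Z} c d phi.

(** Over the open definable set a where phi maps c into d, the chart expression
of phi is a morphism g to the domain of d. The relation is the image of a under
the pair of the inclusion and g, so one quantifies over a point of a. *)
Lemma transition_definable (X Z : space M) (c : chart X) (d : chart Z)
    (phi : morphism X Z) :
  @fdefinable _ M ('I_(cdim c) + 'I_(cdim d))%type (transition c d phi).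
Proof.
pose f := comp_morphism phi (cmap c).
have oO := preimage_gop (@mfun_strict _ _ _ f) (oemb_range (cmap_oemb d)).
have [a aE] := open_chart (cdef c) oO.
have [z|g gE] := oemb_factor (f := comp_morphism f (cmap a)) (cmap_oemb d).
  suff : (f @^-1` range (cmap d)) (cmap a z) by [].
  by rewrite -aE; exists z.
pose V : finType := ('I_(cdim a) + ('I_(cdim c) + 'I_(cdim d)))%type.
pose r (i : 'I_(cdim a) + 'I_(cdim c)) : V :=
  match i with inl i => inl i | inr i => inr (inl i) end.
pose s (i : 'I_(cdim a) + 'I_(cdim d)) : V :=
  match i with inl i => inl i | inr i => inr (inr i) end.
have := fdefinableI (fdefinable_preim r (morphism_graph_definable (cmap a)))
  (fdefinable_preim s (morphism_graph_definable g)).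
move=> /(fdefinable_image inr); congr fdefinable; apply/seteqP; split=> z.
  move=> [w [[x xw axw] [x' xw' gxw]] <-].
  have xx' : x' = x by apply: val_inj; rewrite xw xw'.
  subst x'; exists (cmap a x), (g x); split=> //.
move=> [x [y [xz yz xy]]].
have : (f @^-1` range (cmap d)) x by exists y; rewrite /= ?xy.
rewrite -aE => -[u _ ux].
have gy : g u = y by apply: (oemb_inj (cmap_oemb d)); rewrite gE /= ux xy.
exists (fun i : V => match i with inl i => val u i | inr i => z i end) => //.
by split; exists u => //; rewrite ?ux ?gy ?xz ?yz.
Qed.

End Transition.

Arguments transition {L M X Z} c d phi.

Section Limit.
Context {L : signature} (M : wt_structure L).
Context (J : category) (F : functor J (LDS M)).
Context (N : nat) (e : 'I_N -> J).
Hypothesis homfin : forall i j : J, finite_type (hom i j).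

Let X k : space M := sval (F (e k)).

Let fmor i j (a : hom i j) : morphism (sval (F i)) (sval (F j)) := fmap F a.

(** The index e k runs over the objects with repetitions; the compatibility
condition for identities makes repeated entries agree. *)
Definition limit_set : Type :=
  {x : forall k, X k | forall k l (a : hom (e k) (e l)), fmor a (x k) = x l}.

Definition limit_proj k (t : limit_set) : X k := sval t k.

Lemma limit_proj_inj t t' :
  (forall k, limit_proj k t = limit_proj k t') -> t = t'.
Proof.
case: t t' => x xP [x' xP'] /= h.
have xx' : x = x' by exact: functional_extensionality_dep.
by subst x'; congr exist; exact: Prop_irrelevance.
Qed.

(** A tuple of chart coordinates belongs to a compatible family if every arrow
relates its entries; as there are finitely many arrows, this is a finite
conjunction of transition relations. *)
Lemma limit_joint_dom_definable (c : forall k, chart (X k)) :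
  definable (joint_dom limit_proj c).
Proof.
pose V := joint_var c.
pose inj k (i : 'I_(cdim (c k))) : V := Tagged (fun k => 'I_(cdim (c k))) i.
pose inj2 k l (i : 'I_(cdim (c k)) + 'I_(cdim (c l))) : V :=
  match i with inl i => inj k i | inr i => inj l i end.
have h1 : @fdefinable _ M V [set w : V -> M | forall k, cdom (c k) (w \o inj k)].
  by apply: fdefinable_forall => k; apply: fdefinable_pull; exact: cdef.
have h2 : @fdefinable _ M V [set w : V -> M | forall k l (a : hom (e k) (e l)),
    transition (c k) (c l) (fmor a) (w \o inj2 k l)].
  apply: fdefinable_forall => k; apply: fdefinable_forall => l.
  have [q [h hsurj]] := homfin (e k) (e l).
  have := @fdefinable_forall _ M V 'I_q (fun i => [set w : V -> M |
    transition (c k) (c l) (fmor (h i)) (w \o inj2 k l)])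
    (fun i => fdefinable_preim (inj2 k l) (transition_definable _ _ _)).
  congr fdefinable; apply/seteqP; split=> w //= hw a.
  by have [i <-] := hsurj a.
have := fdefinableI h1 h2; congr definable; apply/seteqP; split=> z.
  move=> [cz az].
  pose x k : cdom (c k) := exist _ (joint_block k z) (mem_set (cz k)).
  have xP k l (a : hom (e k) (e l)) :
      fmor a (cmap (c k) (x k)) = cmap (c l) (x l).
    have [y [y' [yz yz' yy']]] := az k l a.
    rewrite (_ : x k = y); last by apply: val_inj; rewrite yz.
    by rewrite (_ : x l = y') //; apply: val_inj; rewrite yz'.
  by exists (exist _ (fun k => cmap (c k) (x k)) xP) => k; exists (x k).
move=> [t tz]; split=> [k|k l a].
  have [x xz _] := tz k; suff : cdom (c k) (joint_block k z) by [].
  by rewrite -xz; exact: set_valP.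
have [x xz xt] := tz k; have [y yz yt] := tz l.
by exists x, y; split=> //; rewrite xt yt; exact: (svalP t).
Qed.

Hypothesis esurj : forall j, exists k, e k = j.

(** Over an object j the leg is a projection followed by the arrow f j from
some object e (s j); the section g j of f j makes the choice of s j
irrelevant. *)
Lemma limit_exists : exists K : cone F, is_limit K.
Proof.
have ex k : exists C : set (chart (X k)), atlas C.
  by apply/locally_definableP; exact: (svalP (F (e k))).
pose C k := sval (cid (ex k)).
have atlasC k : atlas (C k) by exact: (svalP (cid (ex k))).
have dm c : (forall k, C k (c k)) -> definable (joint_dom limit_proj c).
  by move=> _; exact: limit_joint_dom_definable.
pose S := initial_space dm.
have ldS : locally_definable S.
  apply/locally_definableP; eexists.
  exact: (initial_atlas atlasC limit_proj_inj dm).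
have exP := initial_leg atlasC limit_proj_inj dm.
pose P k := sval (cid (exP k)).
have PE k : mfun (P k) = limit_proj k by exact: (svalP (cid (exP k))).
have Pnat k l (a : hom (e k) (e l)) : comp_morphism (fmor a) (P k) = P l.
  apply: morphism_eq; apply/funext => t /=; rewrite !PE.
  exact: (svalP t).
have lift j : exists k (f : hom (e k) j) (g : hom j (e k)), comp f g = idc j.
  by have [k <-] := esurj j; exists k, (idc _), (idc _); exact: comp_idl.
pose s j := sval (cid (lift j)); have sP j := svalP (cid (lift j)).
pose f j : hom (e (s j)) j := sval (cid (sP j)).
have fP j := svalP (cid (sP j)).
pose g j : hom j (e (s j)) := sval (cid (fP j)).
have fg j : comp (f j) (g j) = idc j := svalP (cid (fP j)).
pose leg j : morphism S (sval (F j)) := comp_morphism (fmor (f j)) (P (s j)).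
have legE k : leg (e k) = P k by exact: Pnat.
pose apexS : LDS M := exist _ S ldS.
have leg_nat i j (a : hom i j) :
    comp (fmap F a) (leg i : hom apexS (F i)) = (leg j : hom apexS (F j)).
  (* By compatibility, the projection to e (s j) is the one to e (s i) followed
     by the arrow g j a (f i). *)
  have -> : (leg j : hom apexS (F j)) =
      comp (fmap F (f j)) (comp (fmap F (comp (g j) (comp a (f i))))
        (P (s i) : hom apexS (F (e (s i))))).
    congr comp; exact/esym/Pnat.
  rewrite compA -fmap_comp [comp (f j) _]compA fg comp_idl fmap_comp -compA.
  by [].
exists (@Cone J (LDS M) F apexS leg leg_nat) => -[[Z ldZ] q qnat].
pose qm j : morphism Z (sval (F j)) := q j.
have qE i j (a : hom i j) z : fmor a (qm i z) = qm j z.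
  exact: (congr1 (fun h : morphism Z (sval (F j)) => h z) (qnat i j a)).
(* A cone is sent to the families of its values. *)
pose compatible (x : forall k, X k) :=
  forall k l (a : hom (e k) (e l)), fmor a (x k) = x l.
pose u z : limit_set :=
  exist compatible (fun k => qm (e k) z) (fun k l a => qE _ _ a z).
have [|v vE] := initial_lift atlasC limit_proj_inj dm (f := u) ldZ.
  by move=> k; exists (qm (e k)).
exists v; split=> [j|w wE].
  apply: morphism_eq; apply/funext => z /=.
  by rewrite PE vE /=; exact: qE.
apply: morphism_eq; apply/funext => z; rewrite vE.
apply: limit_proj_inj => k.
have -> : limit_proj k (w z) = leg (e k) (w z) by rewrite legE PE.
exact/esym/(congr1 (fun h : morphism Z (X k) => h z) (wE (e k))).
Qed.

End Limit.

Theorem theorem6p7 (L : signature) (M : wt_structure L) :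
  finitely_complete (LDS M).
Proof.
by move=> J [[N [e esurj]] homfin] F; exact: limit_exists homfin esurj.
Qed.
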